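(* Let $n\ge 1$, and let $V:\mathbb{R}\to\mathbb{R}$ be a convex function of class $C^{2n+1}$ such that $\mu(dx)=e^{-V(x)}dx$ is a probability measure on $\mathbb{R}$. Define $E_1=V''$ and, recursively, as long as $E_{j-1}$ is defined and everywhere positive, $E_j=E_{j-1}\bigl(1+\mathcal{A}(E_{j-1}^{-1})\bigr)$, where $\mathcal{A}$ is the nonlinear operator given in the context. Assume that $E_1,\dots,E_n$ are (defined and) positive functions on $\mathbb{R}$. For a compactly supported function $f:\mathbb{R}\to\mathbb{R}$ of class $C^{n+1}$ define $$f_1=f',\qquad f_j=E_{j-1}^{1/2}\,D\bigl[E_{j-1}^{-1}f_{j-1}\bigr]\quad (2\le j\le n).$$ Then for every such $f$, $$\mathrm{Var}_\mu(f)=\sum_{j=1}^{n}(-1)^{j-1}\bigl\|E_j^{-1/2}f_j\bigr\|^2+(-1)^n\Bigl\langle (I+DE_n^{-1}D^* )^{-1}D[E_n^{-1}f_n],\,D[E_n^{-1}f_n]\Bigr\rangle .$$ In particular, if $n$ is even, $$\mathrm{Var}_\mu(f)\ge\sum_{j=1}^{n}(-1)^{j-1}\bigl\|E_j^{-1/2}f_j\bigr\|^2,$$ and if $n$ is odd, $$\mathrm{Var}_\mu(f)\le\sum_{j=1}^{n}(-1)^{j-1}\bigl\|E_j^{-1/2}f_j\bigr\|^2 .$$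
   Context: $\langle\cdot,\cdot\rangle$ and $\|\cdot\|$ denote the inner product and norm of the real space $L^2(\mu)$, and $\mathrm{Var}_\mu(f)=\int f^2\,d\mu-\left(\int f\,d\mu\right)^2$. $D\phi=\phi'$ is differentiation and $D^*\phi=-\phi'+V'\phi$ is its formal adjoint in $L^2(\mu)$. A function is also used to denote the operator of multiplication by it; powers such as $E^{-1}$, $E^{1/2}$ of a positive function are pointwise powers. For a positive twice differentiable function $E$ on $\mathbb{R}$, $\mathcal{A}(E)$ is the function $$\mathcal{A}(E)(x)=\frac14\left(2E''(x)+2V'(x)E'(x)-\frac{E'(x)^2}{E(x)}+4E(x)V''(x)\right).$$ For a positive continuous function $E$, $DE^{-1}D^*$ denotes the nonnegative self-adjoint operator on $L^2(\mu)$ associated with the closure of the quadratic form $\phi\mapsto\int E^{-1}(D^*\phi)^2\,d\mu$, $\phi\in C_c^\infty(\mathbb{R})$; $I$ is the identity, and $(I+DE^{-1}D^* )^{-1}$ is the corresponding bounded inverse on $L^2(\mu)$. *)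

(* Defs.v *)
From HB Require Import structures.
From mathcomp Require Import all_boot all_order all_algebra.
From mathcomp Require Import all_classical all_reals all_analysis.

Set Implicit Arguments.
Unset Strict Implicit.
Unset Printing Implicit Defensive.

Import Order.TTheory GRing.Theory Num.Theory.
Import numFieldNormedType.Exports.

Local Open Scope classical_set_scope.
Local Open Scope ring_scope.

Section Regularity.
Context (R : realType).
Implicit Type f : R -> R.

Definition class_C (k : nat) f : Prop :=
  (forall j, (j < k)%N -> forall x, derivable (derive1n j f) x 1) /\
  continuous (derive1n k f).

Definition compact_support f : Prop := compact (closure [set x | f x != 0]).

Definition test_function : set (R -> R) :=
  [set phi | (forall k, class_C k phi) /\ compact_support phi].

End Regularity.

Section L2.
Context (R : realType) (mu : {measure set (measurableTypeR R) -> \bar R}).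
Implicit Types f g : R -> R.

(* Elements of L^2(mu) are represented by functions in [Lfun mu 2], i.e.
   measurable functions with finite L^2 norm; integrals, closed forms, operator
   graphs and resolvents below are insensitive to mu-a.e. changes. *)

Definition L2inner f g : R := \int[mu]_x (f x * g x).

Definition L2norm f : R := fine ('N[mu]_2%:E [EFin \o f])%E.

Definition Var f : R := \int[mu]_x (f x ^+ 2) - (\int[mu]_x f x) ^+ 2.

End L2.

(* The nonnegative self-adjoint operator associated with the closure of a
   nonnegative (closable, densely defined) quadratic form [q] with initial
   domain [C], a subspace of L^2(mu). *)
Section ClosedForm.
Context (R : realType) (mu : {measure set (measurableTypeR R) -> \bar R}).
Variables (C : set (R -> R)) (q : (R -> R) -> R).

Definition form_approx (u_ : nat -> R -> R) (u : R -> R) : Prop :=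
  [/\ forall k, C (u_ k),
      ('N[mu]_2%:E [EFin \o (u_ k \- u)%R])%E @[k --> \oo] --> 0%E &
      forall e, 0 < e -> exists N, forall k m,
        (N <= k)%N -> (N <= m)%N -> q (u_ k \- u_ m) < e].

Definition form_dom : set (R -> R) :=
  [set u | u \in Lfun mu 2%:E /\ exists u_, form_approx u_ u].

(* For closable [q] and [u] in [form_dom] the limit exists and does not depend
   on the approximating sequence. *)
Definition form_closure (u : R -> R) : R :=
  xget 0 [set l | exists2 u_, form_approx u_ u & q (u_ k) @[k --> \oo] --> l].

Definition form_polar (u v : R -> R) : R :=
  (form_closure (u \+ v) - form_closure (u \- v)) / 4.

(* [form_op u w]: u is in the domain of the operator, and w is its image. *)
Definition form_op (u w : R -> R) : Prop :=
  [/\ form_dom u, w \in Lfun mu 2%:E &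
      forall v, form_dom v -> form_polar u v = L2inner mu w v].

End ClosedForm.

(* (I + A)^{-1} g for an operator A given by its graph; (I + A) u = g means
   A u = g - u.  For A nonnegative self-adjoint and g in L^2 such a u exists
   and is unique modulo a.e. equality; the default value 0 is never used. *)
Definition inv_id_plus (R : realType) (A : (R -> R) -> (R -> R) -> Prop)
    (g : R -> R) : R -> R :=
  xget (cst 0) [set u | A u (g \- u)].

Section Operators.
Context (R : realType).
Implicit Types V E f phi : R -> R.

Definition Dstar V phi : R -> R := fun x => - derive1 phi x + derive1 V x * phi x.

Definition DEinvDstar (mu : {measure set (measurableTypeR R) -> \bar R}) V E :
    (R -> R) -> (R -> R) -> Prop :=
  form_op mu (@test_function R)
    (fun phi => \int[mu]_x ((E x)^-1 * (Dstar V phi x) ^+ 2)).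

Definition calA V E : R -> R := fun x =>
  4^-1 * (2 * derive1n 2 E x + 2 * derive1 V x * derive1 E x
          - derive1 E x ^+ 2 / E x + 4 * E x * derive1n 2 V x).

(* [Eseq V j] and [fseq V f j] are E_j and f_j for j >= 1; the values at index 0
   are dummies. *)
Definition Eseq V (j : nat) : R -> R :=
  iter j.-1 (fun E x => E x * (1 + calA V (fun y => (E y)^-1) x)) (derive1n 2 V).

Definition D_Einv E f : R -> R := derive1 (fun y => (E y)^-1 * f y).

Fixpoint fseq V f (j : nat) : R -> R :=
  match j with
  | 0 => f
  | k.+1 => if k is 0 then derive1 f
            else fun x => Num.sqrt (Eseq V k x) * D_Einv (Eseq V k) (fseq V f k) x
  end.

End Operators.

(* Main.v *)
(* With L = D* D, one has D D* = L + V'', so Var f = <f', psi_1> where psi_1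
   solves (L + E_1) psi_1 = f'.  If psi solves (L + E_j) psi = f_j, then
   E_j^(-1/2) psi' solves (L + E_{j+1}) psi = f_{j+1}, and u_j = psi' is
   (I + D E_j^(-1) D* )^(-1) D[E_j^(-1) f_j]; each step trades <psi_j, f_j> for
   |E_j^(-1/2) f_j|^2 - <psi_{j+1}, f_{j+1}> by an integration by parts against
   a compactly supported function.
   The analytic point is that u_n lies in the domain of the closed form.  Outside
   the support of f, psi_1 is a multiple of the Mills ratio e^V mu(]x, +oo[),
   which is negligible with respect to the solution e^V of the same homogeneous
   equation; this domination is inherited by all the ranks, because the equation
   of each rank has a positive potential and a constant Wronskian.  Hence
   psi_n psi_n' <= 0 at +oo (and >= 0 at -oo), so that the energy of u_n is finite
   and e^(-V) u_n decreases to 0; truncating e^(-V) u_n at small values then gives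
   compactly supported approximations, which are finally mollified. *)
Require Import Defs.
From HB Require Import structures.
From mathcomp Require Import all_boot all_order all_algebra.
From mathcomp Require Import all_classical all_reals all_analysis.
From mathcomp Require Import measurable_realfun ring lra zify.

Set Implicit Arguments.
Unset Strict Implicit.
Unset Printing Implicit Defensive.

Import Order.TTheory GRing.Theory Num.Theory.
Import numFieldNormedType.Exports.

Local Open Scope classical_set_scope.
Local Open Scope ring_scope.

(** All solutions are explicit: the first is [expR (V x)] times a primitive, and each later one is a
    formula in the previous pair [(y, th)], with [th = expR (- V) * y'], whose value at [x] depends
    linearly on that pair and on the right-hand side at [x]. Hence, outside the support of [f], the
    actual solution is a multiple of the same formula started from a Mills ratio, which solves the
    homogeneous equation on the whole line. The sign of [y * th] at one rank does not visibly
    determine the sign at the next; this is why the induction carries a comparison with a second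
    solution instead. Nothing bounds [E_n] from below near infinity, so a cut-off [chi] in the space
    variable would leave a term [E^-1 (u chi')^2] out of control. A cut-off that is a function of
    [th = expR (- V) * u] brings in [th'], which off the support of [f] and up to sign is
    [expR (- V)] times [Dstar V u]; that quantity is controlled by the energy itself. *)

(* A synonym of [is_derive _ 1] that is hidden from type class resolution. *)
Definition isd (R : realType) (x : R) (f : R -> R) (a : R) : Prop :=
  is_derive x 1 f a.

(** * Pointwise derivatives and monotonicity *)

Section Derivation.
Context {R : realType}.
Implicit Types (f g : R -> R) (x a b : R).

Lemma isd_eq f x a b : isd x f a -> a = b -> isd x f b.
Proof. by move=> fa <-. Qed.

Lemma isd_cst (c x : R) : isd x (fun=> c) 0.
Proof. exact: is_derive_cst. Qed.

Lemma isd_id x : isd x (fun y : R => y) 1.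
Proof. exact: is_derive_id. Qed.

Lemma isdD f g x a b : isd x f a -> isd x g b ->
  isd x (fun y => f y + g y) (a + b).
Proof. by move=> fa gb; exact: is_deriveD. Qed.

Lemma isdN f x a : isd x f a -> isd x (fun y => - f y) (- a).
Proof. by move=> fa; exact: is_deriveN. Qed.

Lemma isdM f g x a b : isd x f a -> isd x g b ->
  isd x (fun y => f y * g y) (a * g x + f x * b).
Proof.
rewrite /isd => fa gb; have fg := is_deriveM fa gb.
by apply: (isd_eq fg); rewrite addrC [a * _]mulrC.
Qed.

Lemma isd_comp f g x a b : isd (g x) f a -> isd x g b ->
  isd x (fun y => f (g y)) (a * b).
Proof. by move=> fa gb; exact: (is_derive1_comp fa gb). Qed.

Lemma isdX f n x a : isd x f a ->
  isd x (fun y => f y ^+ n) (n%:R * f x ^+ n.-1 * a).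
Proof.
move=> fa; elim: n => [|n IH].
  by rewrite !mul0r; exact: isd_cst.
under eq_fun do rewrite exprS; apply: isd_eq; first exact: (isdM fa IH).
case: n {IH} => [|n] /=; first by rewrite expr0; ring.
by rewrite exprS -[n.+2]addn1 natrD; ring.
Qed.

Lemma isd_exp f x a : isd x f a ->
  isd x (fun y => expR (f y)) (expR (f x) * a).
Proof. by move=> fa; apply: isd_comp => //; exact: is_derive_expR. Qed.

Lemma isdV f x a : f x != 0 -> isd x f a ->
  isd x (fun y => (f y)^-1) (- (f x ^- 2) * a).
Proof. by move=> f0 fa; exact: is_deriveV. Qed.

Lemma isd_sqrt f x a : 0 < f x -> isd x f a ->
  isd x (fun y => Num.sqrt (f y)) ((2 * Num.sqrt (f x))^-1 * a).
Proof.
by move=> f0 fa; apply: isd_comp => //; exact: is_derive1_sqrt.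
Qed.

Lemma isd_opp f x a : isd (- x) f a ->
  isd x (fun y => f (- y)) (- a).
Proof.
move=> fa; apply: isd_eq; first apply: isd_comp fa (isdN (isd_id x)).
by rewrite mulrN1.
Qed.

Lemma isd_derive1 f x : derivable f x 1 -> isd x f (derive1 f x).
Proof. by move=> /derivableP; rewrite derive1E. Qed.

Lemma isd_derivable f x a : isd x f a -> derivable f x 1.
Proof. by case. Qed.

Lemma isd_val f x a : isd x f a -> derive1 f x = a.
Proof. by case=> _; rewrite derive1E. Qed.

Lemma isd_fun f g : (forall x, isd x f (g x)) -> derive1 f = g.
Proof. by move=> fg; apply/funext => x; exact: isd_val. Qed.

Lemma isd_near f g x a : (\near x, f x = g x) -> isd x f a ->
  isd x g a.
Proof. by move=> fg; exact: near_eq_is_derive. Qed.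

Lemma isd_continuous f g : (forall x, isd x f (g x)) -> continuous f.
Proof.
move=> fg x; apply/differentiable_continuous/derivable1_diffP.
exact: isd_derivable (fg x).
Qed.

Lemma isd_ge0_le f g (x y : R) : (forall z, isd z f (g z)) -> x <= y ->
  (forall z, x < z < y -> 0 <= g z) -> f x <= f y.
Proof.
move=> fg xy g0.
apply: (@ger0_derive1_le_cc _ f x y) => //.
- by move=> z _; exact: isd_derivable (fg z).
- by move=> z; rewrite in_itv/= => /g0; rewrite (isd_val (fg z)).
- apply: continuous_subspaceT; exact: isd_continuous fg.
- by rewrite in_itv/= lexx.
- by rewrite in_itv/= lexx andbT.
Qed.

Lemma isd_le0_ge f g (x y : R) : (forall z, isd z f (g z)) -> x <= y ->
  (forall z, x < z < y -> g z <= 0) -> f y <= f x.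
Proof.
move=> fg xy g0; rewrite -lerN2.
apply: (@isd_ge0_le (fun x => - f x) (fun x => - g x)) => // [z|z zxy].
  exact: isdN.
by rewrite oppr_ge0 g0.
Qed.

Lemma isd_eq0_eq f g : (forall z, isd z f (g z)) ->
  (forall z, g z = 0) -> forall x y, f x = f y.
Proof.
move=> fg g0 x y; apply: is_derive_0_is_cst => z.
by have := fg z; rewrite g0.
Qed.

End Derivation.

(* [der tac] computes a derivative, [tac] closing the goals about atoms; what
   remains is the equality with the expected value. *)
Ltac der1 tac :=
  match goal with
  | |- isd _ (fun=> ?c) _ => exact: isd_cst
  | |- isd _ (fun y => y) _ => exact: isd_id
  | |- _ => solve [tac]
  | |- isd _ (fun y => @?f y + @?g y) _ => apply: (@isdD _ f g); der1 tac
  | |- isd _ (fun y => - @?f y) _ => apply: (@isdN _ f); der1 tac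
  | |- isd _ (fun y => @?f y * @?g y) _ => apply: (@isdM _ f g); der1 tac
  | |- isd _ (fun y => @?f y ^+ _) _ => apply: (@isdX _ f); der1 tac
  | |- isd _ (fun y => expR (@?f y)) _ => apply: (@isd_exp _ f); der1 tac
  | |- isd _ (fun y => (@?f y)^-1) _ => apply: (@isdV _ f); der1 tac
  | |- isd _ (fun y => Num.sqrt (@?f y)) _ => apply: (@isd_sqrt _ f); der1 tac
  | |- _ => idtac
  end.
Tactic Notation "der" tactic3(tac) := apply: isd_eq; [der1 tac|cbv beta].

(** * Functions of class [C^k] *)

Section ClassC.
Context {R : realType}.
Implicit Types (f g : R -> R).

Lemma class_C0 f : class_C 0 f <-> continuous f.
Proof. by split => [[]//|cf]; split. Qed.

Lemma class_CS k f : class_C k.+1 f <->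
  (forall x, derivable f x 1) /\ class_C k (derive1 f).
Proof.
split=> [[df cf]|[df [dg cg]]].
  split; first exact: (df 0%N).
  by split=> [j jk x|]; rewrite -derive1Sn//; exact: df.
split; last by rewrite derive1Sn.
by case=> [|j] jk x; [exact: df|rewrite derive1Sn; exact: dg].
Qed.

Lemma class_C_isd k f g : (forall x, isd x f (g x)) -> class_C k g ->
  class_C k.+1 f.
Proof.
move=> fg kg; apply/class_CS; split=> [x|]; first exact: isd_derivable (fg x).
by rewrite (isd_fun fg).
Qed.

Lemma class_C_continuous k f : class_C k f -> continuous f.
Proof.
case: k => [/class_C0//|k /class_CS[df _]].
exact: (@isd_continuous _ f (derive1 f) (fun x => isd_derive1 (df x))).
Qed.

Lemma class_CW k l f : (l <= k)%N -> class_C k f -> class_C l f.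
Proof.
elim: l k f => [k f _ /class_C_continuous /class_C0//|l IH [//|k] f lk].
by move=> /class_CS[df kf]; apply/class_CS; split=> //; exact: (IH k).
Qed.

Lemma class_C_derive1 k f : class_C k.+1 f -> class_C k (derive1 f).
Proof. by move=> /class_CS[]. Qed.

Lemma class_C_is_derive k f x : class_C k.+1 f -> isd x f (derive1 f x).
Proof. by move=> /class_CS[df _]; exact: isd_derive1. Qed.

Lemma class_C_derive1n j k f : class_C (k + j) f -> class_C k (derive1n j f).
Proof.
elim: j f => [|j IH] f; first by rewrite addn0.
by rewrite addnS derive1Sn => /class_C_derive1; exact: IH.
Qed.

Lemma class_C_cst k (c : R) : class_C k (fun=> c).
Proof.
elim: k c => [|k IH] c; first by apply/class_C0 => x; exact: cvg_cst.
by apply: (@class_C_isd _ _ (fun=> 0)) => // x; exact: isd_cst.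
Qed.

Lemma class_CD k f g : class_C k f -> class_C k g ->
  class_C k (fun x => f x + g x).
Proof.
elim: k f g => [|k IH] f g.
  by move=> /class_C0 cf /class_C0 cg; apply/class_C0 => x; exact: (cvgD (cf x) (cg x)).
move=> kf kg; apply: class_C_isd (IH _ _ (class_C_derive1 kf) (class_C_derive1 kg)).
by move=> x; apply: isdD; [exact: class_C_is_derive kf|exact: class_C_is_derive kg].
Qed.

Lemma class_CN k f : class_C k f -> class_C k (fun x => - f x).
Proof.
elim: k f => [|k IH] f.
  by move=> /class_C0 cf; apply/class_C0 => x; exact: (cvgN (cf x)).
move=> kf; apply: class_C_isd (IH _ (class_C_derive1 kf)).
by move=> x; apply: isdN; exact: class_C_is_derive kf.
Qed.

Lemma class_CB k f g : class_C k f -> class_C k g ->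
  class_C k (fun x => f x - g x).
Proof. by move=> kf kg; apply: class_CD => //; exact: class_CN. Qed.

Lemma class_CM k f g : class_C k f -> class_C k g ->
  class_C k (fun x => f x * g x).
Proof.
elim: k f g => [|k IH] f g.
  by move=> /class_C0 cf /class_C0 cg; apply/class_C0 => x; exact: (cvgM (cf x) (cg x)).
move=> kf kg; have [kf' kg'] := (class_CW (leqnSn k) kf, class_CW (leqnSn k) kg).
apply: class_C_isd (class_CD (IH _ _ (class_C_derive1 kf) kg')
  (IH _ _ kf' (class_C_derive1 kg))).
by move=> x; apply: isdM; [exact: class_C_is_derive kf|exact: class_C_is_derive kg].
Qed.

Lemma class_CX k f m : class_C k f -> class_C k (fun x => f x ^+ m).
Proof.
move=> kf; elim: m => [|m IH]; first exact: class_C_cst.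
by under eq_fun do rewrite exprS; exact: class_CM.
Qed.

Lemma class_CV k f : (forall x, f x != 0) -> class_C k f ->
  class_C k (fun x => (f x)^-1).
Proof.
move=> f0; elim: k => [|k IH].
  by move=> /class_C0 cf; apply/class_C0 => x; apply: cvgV => //; exact: cf.
move=> kf; have kf' := class_CW (leqnSn k) kf.
apply: class_C_isd (class_CM (class_CN (class_CX 2 (IH kf')))
   (class_C_derive1 kf)) => x.
by rewrite exprVn; apply: isdV => //; exact: class_C_is_derive kf.
Qed.

Lemma class_C_sqrt k f : (forall x, 0 < f x) -> class_C k f ->
  class_C k (fun x => Num.sqrt (f x)).
Proof.
move=> f0; elim: k => [|k IH].
  move=> /class_C0 cf; apply/class_C0 => x.
  by apply: continuous_cvg; [exact: sqrt_continuous|exact: cf].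
move=> kf; have kf' := class_CW (leqnSn k) kf.
have s0 x : 2 * Num.sqrt (f x) != 0.
  by rewrite mulf_neq0// gt_eqF// sqrtr_gt0.
have := class_CM (class_CV s0 (class_CM (class_C_cst k 2) (IH kf')))
  (class_C_derive1 kf).
apply: class_C_isd => x.
by apply: isd_sqrt => //; exact: class_C_is_derive kf.
Qed.

Lemma class_C_expR k f : class_C k f -> class_C k (fun x => expR (f x)).
Proof.
elim: k => [|k IH].
  move=> /class_C0 cf; apply/class_C0 => x.
  by apply: continuous_cvg; [exact: continuous_expR|exact: cf].
move=> kf; have kf' := class_CW (leqnSn k) kf.
apply: class_C_isd (class_CM (IH kf') (class_C_derive1 kf)) => x.
by apply: isd_exp; exact: class_C_is_derive kf.
Qed.

Lemma class_C_affine k f (a b : R) : class_C k f -> class_C k (fun x => f (a * x + b)).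
Proof.
elim: k f => [|k IH] f.
  move=> /class_C0 cf; apply/class_C0 => x.
  apply: (@continuous_comp _ _ _ (fun x => a * x + b) f); last exact: cf.
  by apply: cvgD; [apply: cvgM; [exact: cvg_cst|exact: cvg_id]|exact: cvg_cst].
move=> kf; apply: class_C_isd (class_CM (IH _ (class_C_derive1 kf)) (class_C_cst k a)).
move=> x; apply: (@isd_comp _ f (fun x => a * x + b)).
  exact: class_C_is_derive kf.
by der fail; rewrite mul0r mulr1 add0r addr0.
Qed.

Lemma class_C_sum k (I : Type) (r : seq I) (P : pred I) (F : I -> R -> R) :
  (forall i, class_C k (F i)) -> class_C k (fun x => \sum_(i <- r | P i) F i x).
Proof.
move=> kF; elim: r => [|i r IH].
  under eq_fun do rewrite big_nil; exact: class_C_cst.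
under eq_fun do rewrite big_cons; case: (P i) => //; exact: class_CD.
Qed.

(** Replaces formulas for higher derivatives by a family closed under differentiation; the family in
    view is that of all [flat p]. *)
Lemma class_C_coind (F : set (R -> R)) :
  (forall f, F f -> exists2 g, F g & forall x, isd x f (g x)) ->
  forall k f, F f -> class_C k f.
Proof.
move=> Fd; elim=> [|k IH] f /Fd[g Fg fg].
  exact/class_C0/(isd_continuous fg).
by apply: class_C_isd fg _; exact: IH.
Qed.

End ClassC.

(** * Functions vanishing outside [[-K, K]] *)

Definition supported (R : realType) (K : R) (f : R -> R) :=
  forall x, K < `|x| -> f x = 0.

Section Supported.
Context {R : realType}.
Implicit Types (f g : R -> R) (K : R).

Lemma supported_isd K f g : (forall x, isd x f (g x)) ->
  supported K f -> supported K g.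
Proof.
move=> fg fK x Kx; rewrite -(isd_val (fg x)).
apply: isd_val; apply: isd_near (isd_cst 0 x).
have : \forall y \near x, K < `|y|.
  have /cvgr_gt := @norm_continuous R R^o x.
  by apply.
by apply: filterS => y /fK ->.
Qed.

Lemma supportedMl K f g : supported K f -> supported K (fun x => f x * g x).
Proof. by move=> fK x /fK ->; rewrite mul0r. Qed.

Lemma supportedMr K f g : supported K g -> supported K (fun x => f x * g x).
Proof. by move=> gK x /gK ->; rewrite mulr0. Qed.

Lemma supported_compact K f : supported K f -> compact_support f.
Proof.
move=> fK; apply: (@subclosed_compact _ _ `[-K, K]%classic).
- exact: closed_closure.
- exact: segment_compact.
- rewrite closureE; apply: smallest_sub; first exact: interval_closed.
  move=> x /=; rewrite in_itv/= -ler_norml leNgt; apply: contra => /fK ->.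
  exact/eqP.
Qed.

Lemma compact_supported f : compact_support f -> exists2 K, 0 < K & supported K f.
Proof.
move=> /compact_bounded[M [Mr MB]].
exists (`|M| + 1); first by rewrite ltr_wpDl.
move=> x Mx; apply/eqP; apply: contraTT Mx => fx0; rewrite -leNgt.
apply: (MB (`|M| + 1)); first by rewrite (le_lt_trans (ler_norm M))// ltrDl.
exact: subset_closure.
Qed.

Lemma continuous_bounded_segment f (K : R) : continuous f ->
  exists2 M, 0 < M & forall x, `|x| <= K -> `|f x| <= M.
Proof.
move=> cf; have : compact (f @` `[-K, K]%classic).
  apply: continuous_compact; last exact: segment_compact.
  exact: continuous_subspaceT.
move=> /compact_bounded[M [Mr MB]].
exists (`|M| + 1); first by rewrite ltr_wpDl.
move=> x Kx; apply: (MB (`|M| + 1)).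
  by rewrite (le_lt_trans (ler_norm M))// ltrDl.
by exists x => //=; rewrite in_itv/= -ler_norml.
Qed.

Lemma supported_bounded f K : continuous f -> supported K f ->
  exists2 M, 0 < M & forall x, `|f x| <= M.
Proof.
move=> cf fK; have [M M0 fM] := continuous_bounded_segment K cf.
exists M => // x; have [|/fK ->] := leP `|x| K; first exact: fM.
by rewrite normr0 ltW.
Qed.

End Supported.

(** * A smooth step and a smooth plateau *)

Section SmoothStep.
Context {R : realType}.

(** Serves for [flat p] at 0, where its two defining formulas meet. *)
Lemma isd_quadratic_zero (f : R -> R) (C : R) :
  (forall x, `|f x| <= C * x ^+ 2) -> isd 0 f 0.
Proof.
move=> fC; have f0 : f 0 = 0.
  by apply/eqP; rewrite -normr_le0 (le_trans (fC 0))// expr0n mulr0.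
apply/is_derive1_caratheodory; exists (fun z => f z / z); split.
- by move=> z; rewrite f0 !subr0; have [->|z0] := eqVneq z 0;
    [rewrite f0 mulr0|rewrite divfK].
- apply/(@cvgrPdist_le _ R^o) => e e0; rewrite f0 mul0r.
  have C1 : 0 < `|C| + 1 by rewrite ltr_wpDl.
  near=> z; rewrite sub0r normrN normrM.
  have [->|z0] := eqVneq z 0; first by rewrite f0 normr0 mul0r ltW.
  rewrite normfV ler_pdivrMr ?normr_gt0//.
  apply: (le_trans (fC z)).
  rewrite -real_normK ?num_real// expr2 mulrA ler_wpM2r//.
  apply: (@le_trans _ _ ((`|C| + 1) * `|z|)).
    by rewrite ler_wpM2r// (le_trans (ler_norm _))// lerDl.
  rewrite mulrC -ler_pdivlMr//.
  near: z; apply: (cvgr_le 0); last exact: divr_gt0.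
  by rewrite -[X in _ --> X](@normr0 _ R^o); exact: (@norm_continuous R R^o 0).
- by rewrite f0 mul0r.
Unshelve. all: by end_near. Qed.

(** A family containing [exp(-1/x)] and closed under differentiation: with [t = 1/x],
    differentiating [p(t) exp(-t)] replaces [p] by [(p - p') X^2]. *)
Definition flat (p : {poly R}) (x : R) : R :=
  if 0 < x then p.[x^-1] * expR (- x^-1) else 0.

(** With [t = 1/x], the exponential series gives [t^(i+2) <= (i+2)! exp t], hence
    [t^i exp(-t) <= (i+2)! x^2]; the constant sums these bounds over the coefficients of [p]. *)
Lemma flat_quadratic p : exists C, forall x, `|flat p x| <= C * x ^+ 2.
Proof.
exists (\sum_(i < size p) `|p`_i| * (i.+2)`!%:R) => x; rewrite /flat.
case: ifPn => [x0|_]; last first.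
  rewrite normr0 mulr_ge0 ?sqr_ge0//; apply: sumr_ge0 => i _.
  by rewrite mulr_ge0.
rewrite horner_coef mulr_suml mulr_suml.
apply: (le_trans (ler_norm_sum _ _ _)); apply: ler_sum => i _.
have V0 : 0 <= x^-1 ^+ i by rewrite exprn_ge0// invr_ge0 ltW.
rewrite !normrM -!mulrA ler_wpM2l// (ger0_norm V0) (ger0_norm (expR_ge0 _)).
have := expR_ge1Dxn i.+1 (ltW (_ : 0 < x^-1)); rewrite invr_gt0 => /(_ x0) h.
rewrite expRN ler_pdivrMr ?expR_gt0//.
have {}h : (x^-1) ^+ i.+2 <= (i.+2)`!%:R * expR x^-1.
  rewrite mulrC -ler_pdivrMr ?ltr0n ?fact_gt0//.
  by apply: le_trans h; rewrite lerDr.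
have -> : x^-1 ^+ i = x^-1 ^+ i.+2 * x ^+ 2.
  rewrite -addn2 exprD -mulrA -exprMn mulVf ?gt_eqF// expr1n mulr1//.
by rewrite [leRHS]mulrAC ler_wpM2r// sqr_ge0.
Qed.

Lemma flat_isd p x : isd x (flat p) (flat ((p - deriv p) * 'X ^+ 2) x).
Proof.
have [x0|x0|->] := ltgtP x 0.
- rewrite /flat ltNge (ltW x0)/=; apply: isd_near (isd_cst 0 x).
  have := lt_nbhsl x0.
  by apply: filterS => y y0; rewrite ltNge (ltW y0).
- rewrite {2}/flat x0.
  have : \forall y \near x, p.[y^-1] * expR (- y^-1) = flat p y.
    have := lt_nbhsr x0.
    by apply: filterS => y y0; rewrite /flat y0.
  move=> /isd_near; apply.
  have xn0 : x != 0 by rewrite gt_eqF.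
  have dV : isd x (fun y : R => y^-1) (- (x ^- 2)).
    by apply: isd_eq; [exact: (isdV xn0 (isd_id x))|rewrite mulr1].
  have dp : isd x (fun y => p.[y^-1]) (p^`().[x^-1] * - (x ^- 2)).
    by apply: isd_comp dV; exact: is_derive_poly.
  der (first [exact: dV | exact: dp]).
  rewrite !hornerE /=. by field.
- have [C pC] := flat_quadratic p.
  by rewrite /flat ltxx; exact: (isd_quadratic_zero pC).
Qed.

Lemma flat_class_C p k : class_C k (flat p).
Proof.
apply: (@class_C_coind _ [set f | exists q, f = flat q]); last by exists p.
move=> f [q ->]; exists (flat ((q - deriv q) * 'X ^+ 2)); first by eexists.
exact: flat_isd.
Qed.

Lemma flat1_ge0 x : 0 <= flat 1 x.
Proof.
by rewrite /flat hornerE mul1r; case: ifP => // _; exact: expR_ge0.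
Qed.

Lemma flat1_gt0 x : 0 < x -> 0 < flat 1 x.
Proof. by rewrite /flat hornerE mul1r => ->; exact: expR_gt0. Qed.

Lemma flat1_eq0 x : x <= 0 -> flat 1 x = 0.
Proof. by rewrite /flat ltNge => ->. Qed.

Definition step (x : R) : R := flat 1 x / (flat 1 x + flat 1 (1 - x)).

Lemma step_den_gt0 x : 0 < flat 1 x + flat 1 (1 - x).
Proof.
have [x0|x0] := ltP 0 x.
  by rewrite ltr_pwDl// ?flat1_gt0// flat1_ge0.
by rewrite ltr_wpDl ?flat1_ge0// flat1_gt0// subr_gt0 (le_lt_trans x0).
Qed.

Lemma step_class_C k : class_C k step.
Proof.
apply: class_CM; first exact: flat_class_C.
apply: class_CV; first by move=> x; rewrite gt_eqF// step_den_gt0.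
apply: class_CD; first exact: flat_class_C.
have := class_C_affine (-1) 1 (flat_class_C 1 k).
by under eq_fun do rewrite mulN1r addrC.
Qed.

Lemma step_ge0 x : 0 <= step x.
Proof. by rewrite divr_ge0 ?flat1_ge0// ltW// step_den_gt0. Qed.

Lemma step_le1 x : step x <= 1.
Proof. by rewrite ler_pdivrMr ?step_den_gt0// mul1r lerDl flat1_ge0. Qed.

Lemma step_eq0 x : x <= 0 -> step x = 0.
Proof. by move=> x0; rewrite /step flat1_eq0// mul0r. Qed.

Lemma step_eq1 x : 1 <= x -> step x = 1.
Proof.
move=> x1; have := step_den_gt0 x; rewrite /step (@flat1_eq0 (1 - x)) ?subr_le0//.
by rewrite addr0 => x0; rewrite divff// gt_eqF.
Qed.

Definition plateau (K x : R) : R := step (K + 1 - x) * step (K + 1 + x).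

Lemma plateau_class_C K k : class_C k (plateau K).
Proof.
apply: class_CM.
  have := class_C_affine (-1) (K + 1) (step_class_C k).
  by under eq_fun do rewrite mulN1r addrC.
have := class_C_affine 1 (K + 1) (step_class_C k).
by under eq_fun do rewrite mul1r addrC.
Qed.

Lemma plateau_eq1 K x : `|x| <= K -> plateau K x = 1.
Proof.
by rewrite ler_norml => /andP[x1 x2]; rewrite /plateau !step_eq1 ?mulr1//; lra.
Qed.

Lemma plateau_supported K : supported (K + 1) (plateau K).
Proof.
move=> x Kx; rewrite /plateau; have [x0|x0] := leP 0 x.
  by rewrite step_eq0 ?mul0r//; move: Kx; rewrite ger0_norm//; lra.
by rewrite [X in _ * X]step_eq0 ?mulr0//; move: Kx; rewrite ltr0_norm//; lra.
Qed.

Lemma plateau_ge0 K x : 0 <= plateau K x.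
Proof. by rewrite mulr_ge0 ?step_ge0. Qed.

Lemma plateau_le1 K x : plateau K x <= 1.
Proof. by rewrite mulr_ile1 ?step_ge0 ?step_le1. Qed.

End SmoothStep.

(** * Uniform approximation by test functions, derivative included *)

Lemma unif_continuous_supported (R : realType) (f : R -> R) (K e : R) :
  continuous f -> supported K f -> 0 < e ->
  exists2 d, 0 < d & forall x y, `|x - y| < d -> `|f x - f y| <= e.
Proof.
move=> cf fK e0.
have := @segment_compact R (- (K + 1)) (K + 1).
move=> /(@compact_near_coveringP R^o).
move=> /(_ R (nbhs (0 : R)^'+) (fun d x => forall y, `|x - y| < d -> `|f x - f y| <= e)).
case.
  move=> x _.
  have e2 : 0 < e / 2 by rewrite divr_gt0.
  have /(@cvgrPdist_lt _ R^o) /(_ _ e2) := cf x.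
  move=> /nbhs_ballP[d /= d0 xd].
  exists (ball x (d / 2), [set h | h < d / 2]).
    split=> /=; first by apply: nbhsx_ballx; rewrite divr_gt0.
    by apply: nbhs_right_lt; rewrite divr_gt0.
  move=> [z h] /= [xz hd] y zy.
  have fz := xd z; have fy := xd y.
  rewrite /= /ball /= in fz fy xz.
  have := fz (lt_trans xz _); rewrite ltr_pdivrMr// ltr_pMr// ltr1n => /(_ isT) {}fz.
  have {}fy : `|f x - f y| < e / 2.
    apply: fy; rewrite (le_lt_trans (ler_distD z _ _))//.
    by have := lt_trans zy hd; move: xz; lra.
  rewrite (le_trans (ler_distD (f x) _ _))// distrC.
  by move: fz fy; lra.
move=> /= d /= d0 Hd.
have d2 : 0 < d / 2 by rewrite divr_gt0.
have {}Hd : forall x y, `|x| <= K + 1 -> `|x - y| < d / 2 -> `|f x - f y| <= e.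
  move=> x y xK xy; apply: (Hd (d / 2)) => //=.
  - by rewrite sub0r normrN gtr0_norm// ltr_pdivrMr// ltr_pMr// ltr1n.
  - by rewrite in_itv/= -ler_norml.
exists (Num.min (d / 2) 1); first by rewrite lt_min d2 ltr01.
move=> x y; rewrite lt_min => /andP[xy xy1].
have [xK|xK] := leP `|x| (K + 1); first exact: Hd.
have yK : K < `|y|.
  have : `|x| <= `|x - y| + `|y| by rewrite -{1}(subrK y x) ler_normD.
  by move: xK xy1; lra.
by rewrite !fK// ?subrr ?normr0 ?ltW// (lt_trans _ xK)// ltrDl.
Qed.

Section Mollify.
Context {R : realType}.

Lemma continuous_supported_integrable (f : R -> R) K (A : set R) : measurable A ->
  continuous f -> supported K f -> lebesgue_measure.-integrable A (EFin \o f).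
Proof.
move=> mA cf fK; apply: (integrableS measurableT) => //.
have -> : EFin \o f = (EFin \o f) \_ `[-K, K]%classic.
  apply/funext => x; rewrite patchE /=; case: ifPn => // /negP xK.
  rewrite fK// ltNge; apply/negP => xK'; apply: xK; rewrite inE/= in_itv/=.
  by rewrite -ler_norml.
have /(_ (measurable_itv _))[+ _] :=
  @integrable_mkcond _ _ _ (@lebesgue_measure R) `[-K, K]%classic (EFin \o f).
apply.
apply: continuous_compact_integrable; first exact: segment_compact.
exact: continuous_subspaceT.
Qed.

Lemma supported_primitive (f : R -> R) K : continuous f -> supported K f ->
  exists2 F, forall x, isd x F (f x) & forall x, x < - K -> F x = 0.
Proof.
move=> cf fK.
exists (fun x => \int[lebesgue_measure]_(t in `]-oo, x]) f t)%R.
  move=> x; have x1 : x < x + 1 by rewrite ltrDl.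
  have intf : lebesgue_measure.-integrable `]-oo, (x + 1)] (EFin \o f).
    exact: continuous_supported_integrable fK.
  have [df <-] := continuous_FTC1 x1 intf (ltNyr _) (cf x).
  exact: isd_derive1.
move=> x xK; rewrite (@eq_Rintegral _ _ _ _ _ (cst 0)) ?Rintegral_cst ?mul0r//.
move=> y; rewrite inE/= in_itv/= => yx; apply: fK.
by rewrite ltr_normr orbC ltrNr (le_lt_trans yx).
Qed.

(* smooth partition of unity subordinate to intervals of length [2 * h] *)
Definition hat (h : R) (i : nat) (x : R) : R :=
  step (x / h - i%:R) - step (x / h - i.+1%:R).

Lemma hat_class_C h i k : class_C k (hat h i).
Proof.
apply: class_CB.
- have := class_C_affine h^-1 (- i%:R) (step_class_C k).
  by under eq_fun do rewrite mulrC.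
- have := class_C_affine h^-1 (- i.+1%:R) (step_class_C k).
  by under eq_fun do rewrite mulrC.
Qed.

Lemma hat_ge0 h i x : 0 <= hat h i x.
Proof.
rewrite subr_ge0; have [x1|x1] := leP (x / h - i.+1%:R) 0.
  by rewrite step_eq0// step_ge0.
rewrite [leRHS]step_eq1 ?step_le1//.
by move: x1; rewrite mulrS; lra.
Qed.

Lemma hat_eq0 h i x : 0 < h -> x <= i%:R * h \/ i.+2%:R * h <= x -> hat h i x = 0.
Proof.
move=> h0 [xi|xi]; rewrite /hat.
- have {}xi : x / h <= i%:R by rewrite ler_pdivrMr.
  by rewrite !step_eq0 ?subrr// ?subr_le0// (le_trans xi)// ler_nat.
- have {}xi : i.+2%:R <= x / h by rewrite ler_pdivlMr.
  by move: xi; rewrite !mulrS => xi; rewrite !step_eq1 ?subrr//; lra.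
Qed.

Lemma sum_hat h N x : \sum_(i < N) hat h i x = step (x / h) - step (x / h - N%:R).
Proof.
elim: N => [|N IH]; first by rewrite big_ord0 subr0 subrr.
by rewrite big_ord_recr /= IH /hat addrA subrK.
Qed.

(** The values of [f] at nodes of mesh [h] are blended by the hats, shifted by [L] because [hat] is
    indexed from 0. The hats are nonnegative, sum to at most 1, and to 1 on [[-K, K]], so the error
    is an average of oscillations of [f] over distances below [d]. *)
Lemma approx_continuous (f : R -> R) (K e : R) : 0 < K -> continuous f ->
  supported K f -> 0 < e ->
  exists w, [/\ forall k, class_C k w, supported (K + 1) w &
    forall x, `|w x - f x| <= e].
Proof.
move=> K0 cf fK e0; have [d d0 fd] := unif_continuous_supported cf fK e0.
(* A hat has width [2 * h], at most [d / 2]; the bound 1/4 keeps the hats of nodes in [[-K, K]]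
   inside [[-(K+1), K+1]] and ends the first ramp before [-K]. *)
pose h := Num.min (d / 4) (1 / 4).
have h0 : 0 < h by rewrite lt_min !divr_gt0.
have hd : h <= d / 4 by rewrite ge_min lexx.
have h4 : h <= 1 / 4 by rewrite ge_min lexx orbT.
pose L := K + 1.
pose N := (Num.trunc (2 * L / h)).+1.
have NL : 2 * L < N%:R * h by rewrite -ltr_pdivrMr// truncnS_gt.
pose a i := i%:R * h - L.
exists (fun x => \sum_(i < N) f (a i) * hat h i (x + L)); split.
- move=> k; apply: class_C_sum => i; apply: class_CM; first exact: class_C_cst.
  have := class_C_affine 1 L (hat_class_C h i k).
  by under eq_fun do rewrite mul1r.
- move=> x Kx; apply: big1 => i _.
  have [/fK ->|aK] := ltP K `|a i|; first by rewrite mul0r.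
  rewrite hat_eq0 ?mulr0//; move: aK Kx; rewrite /a ler_norml => /andP[a1 a2].
  rewrite lter_normr => /orP[xK|xK]; [right|left]; rewrite ?mulrS; lra.
- move=> x.
  have E : f x = \sum_(i < N) f x * hat h i (x + L).
    rewrite -mulr_sumr sum_hat; have [xK|/fK ->] := leP `|x| K; last by rewrite mul0r.
    move: xK; rewrite ler_norml => /andP[x1 x2].
    rewrite step_eq1 ?step_eq0 ?subr0 ?mulr1//.
    + by rewrite subr_le0 ler_pdivrMr// (le_trans _ (ltW NL))// /L; lra.
    + by rewrite ler_pdivlMr// mul1r (le_trans h4)// /L; lra.
  rewrite E -sumrB; under eq_bigr do rewrite -mulrBl.
  apply: (le_trans (ler_norm_sum _ _ _)).
  apply: (@le_trans _ _ (\sum_(i < N) e * hat h i (x + L))).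
    apply: ler_sum => i _; rewrite normrM (ger0_norm (hat_ge0 _ _ _)).
    have [xi|xi] := leP (x + L) (i%:R * h); first by rewrite hat_eq0 ?mulr0//; left.
    have [xi'|xi'] := leP (i.+2%:R * h) (x + L); first by rewrite hat_eq0 ?mulr0//; right.
    rewrite ler_wpM2r ?hat_ge0//; apply: fd; rewrite ltr_norml /a.
    move: xi'; rewrite !mulrS; lra.
  rewrite -mulr_sumr sum_hat ger_pMr//.
  by have := step_le1 ((x + L) / h); have := step_ge0 ((x + L) / h - N%:R); lra.
Qed.

(** Since derivatives must be close too, it is [g'] that is approximated, by [w], which is then
    integrated. The primitive [P] may fail to vanish to the right of the support, so it is
    multiplied by a plateau, whose derivative only meets the small difference [P - g]. *)
Lemma mollify (g g' : R -> R) (K e : R) : 0 < K -> (forall x, isd x g (g' x)) ->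
  continuous g' -> supported K g -> 0 < e ->
  exists phi, [/\ forall k, class_C k phi, supported (K + 1) phi,
    (forall x, `|phi x - g x| <= e) &
    (forall x, `|derive1 phi x - g' x| <= e)].
Proof.
move=> K0 dg cg' gK e0.
have g'K := supported_isd dg gK.
pose eta := plateau K.
have dde x : isd x eta (derive1 eta x).
  exact: class_C_is_derive (plateau_class_C K 1).
have [M M0 etaM] : exists2 M, 0 < M & forall x, `|derive1 eta x| <= M.
  apply: (@supported_bounded _ _ (K + 1)).
    exact: class_C_continuous (class_C_derive1 (plateau_class_C K 1)).
  exact: supported_isd dde (@plateau_supported _ K).
(* [2 * K + 4] exceeds the length of [[-(K+2), K+1]], on which [P - g] varies at rate at most
   [e / c]. The value of [c] makes [e / c * (2 * K + 4)], and also [M] times it plus [e / c], at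
   most [e]. *)
pose c := (M + 1) * (2 * K + 4) + 1.
have c0 : 0 < c by rewrite /c; nra.
have ec0 : 0 < e / c by rewrite divr_gt0.
have [w [wC wK wg]] := approx_continuous K0 cg' g'K ec0.
have [P dP P0] := supported_primitive (class_C_continuous (wC 0%N)) wK.
have Pg x : `|x| <= K + 1 -> `|P x - g x| <= e / c * (2 * K + 4).
  rewrite ler_norml => /andP[x1 x2].
  have Z : P (- (K + 2)) - g (- (K + 2)) = 0.
    rewrite P0 ?gK ?subrr//; last by lra.
    by rewrite normrN gtr0_norm; lra.
  have d1 z : isd z (fun y => P y - g y) (w z - g' z) by apply: isdD => //; exact: isdN.
  have wgz z := wg z; have xK : - (K + 2) <= x by lra.
  rewrite ler_norml; apply/andP; split.
    have : (P (- (K + 2)) - g (- (K + 2))) + e / c * - (K + 2) <= P x - g x + e / c * x.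
      apply: (@isd_ge0_le _ (fun y => P y - g y + e / c * y)
        (fun y => w y - g' y + e / c)) => // z.
      - by der (exact: d1); rewrite mul0r mulr1 add0r.
      - by move=> _; have := wg z; rewrite ler_norml; lra.
    rewrite Z; move: ec0 x2; set b := e / c; nra.
  have : P x - g x - e / c * x <= (P (- (K + 2)) - g (- (K + 2))) - e / c * - (K + 2).
    apply: (@isd_le0_ge _ (fun y => P y - g y - e / c * y)
      (fun y => w y - g' y - e / c)) => // z.
    - by der (exact: d1); rewrite mul0r mulr1 add0r.
    - by move=> _; have := wg z; rewrite ler_norml; lra.
  by rewrite Z; move: ec0 x2; set b := e / c; nra.
have etag : (fun x => eta x * g x) = g.
  apply/funext => x; have [xK|/gK ->] := leP `|x| K; last by rewrite mulr0.
  by rewrite /eta plateau_eq1// mul1r.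
have etag' x : derive1 eta x * g x + eta x * g' x = g' x.
  by rewrite -(isd_val (dg x)) -[in RHS]etag; apply/esym/isd_val/isdM; [exact: dde|
    rewrite (isd_val (dg x)); exact: dg].
have dphi x : isd x (fun y => eta y * P y) (derive1 eta x * P x + eta x * w x).
  by apply: isdM; [exact: dde|exact: dP].
have eK := @plateau_supported R K.
have e'K := supported_isd dde eK.
have ecc : e / c * c = e by rewrite divfK// gt_eqF.
exists (fun y => eta y * P y); split.
- move=> k; apply: class_CM; first exact: plateau_class_C.
  by apply: (@class_CW _ k.+1) => //; exact: class_C_isd dP (wC k).
- exact: supportedMl.
- move=> x; rewrite -[g x](congr1 (@^~ x) etag) -mulrBr normrM.
  have [xK|/eK ex] := leP `|x| (K + 1); last by rewrite /eta ex normr0 mul0r ltW.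
  rewrite ger0_norm ?plateau_ge0//.
  apply: (@le_trans _ _ (e / c * (2 * K + 4))).
    apply: le_trans (Pg x xK); rewrite ler_piMl//; exact: plateau_le1.
  rewrite -[leRHS]ecc ler_wpM2l ?ltW// /c; nra.
- move=> x; rewrite (isd_val (dphi x)) -(etag' x).
  have -> : derive1 eta x * P x + eta x * w x - (derive1 eta x * g x + eta x * g' x) =
     derive1 eta x * (P x - g x) + eta x * (w x - g' x) by ring.
  have [xK|xK] := leP `|x| (K + 1); last first.
    by rewrite e'K// /eta eK// !mul0r addr0 normr0 ltW.
  rewrite (le_trans (ler_normD _ _))// (normrM (derive1 eta x)) (normrM (eta x)) (@ger0_norm _ (eta x)) ?plateau_ge0//.
  apply: (@le_trans _ _ (M * (e / c * (2 * K + 4)) + e / c)).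
    apply: lerD; first by apply: ler_pM => //; exact: Pg.
    by rewrite -[leRHS]mul1r; apply: ler_pM => //; [exact: plateau_ge0|exact: plateau_le1].
  rewrite -[leRHS]ecc /c; nra.
Qed.
End Mollify.

(** * The equation as a first-order system; solutions that are small at infinity *)

Section System.
Context {R : realType}.
Implicit Types V E F y th s : R -> R.

(* The equation [D* D y + E y = F] as a first-order system, [th] being
   [expR (- V) * y']. *)
Definition sys V E F y th : Prop :=
  (forall x, isd x y (expR (V x) * th x)) /\
  (forall x, isd x th (expR (- V x) * (E x * y x - F x))).

Local Notation hom V E := (sys V E (fun=> 0)).

(** For [F = 0] and [E > 0] the derivative is a sum of squares with positive weights, whence
    monotonicity in [sys_prod_le]; for general [F] its integral is the energy identity behind
    [fe_u]. *)
Lemma sys_prod V E F y th x : sys V E F y th ->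
  isd x (fun z => y z * th z)
    (expR (V x) * th x ^+ 2 + expR (- V x) * (E x * y x ^+ 2 - y x * F x)).
Proof.
by move=> [dy dth]; der (first [exact: dy | exact: dth]); ring.
Qed.

Lemma sys_lin V E y1 th1 y2 th2 (a b : R) :
  hom V E y1 th1 -> hom V E y2 th2 ->
  hom V E (fun x => a * y1 x + b * y2 x) (fun x => a * th1 x + b * th2 x).
Proof.
move=> [dy1 dth1] [dy2 dth2]; split=> x.
  by der (first [exact: dy1 | exact: dy2]); ring.
by der (first [exact: dth1 | exact: dth2]); ring.
Qed.

Lemma sys_prod_le V E y th (x z : R) : (forall x, 0 < E x) -> hom V E y th ->
  x <= z -> y x * th x <= y z * th z.
Proof.
move=> E0 h xz; apply: (isd_ge0_le (fun x => sys_prod x h)) => // w _.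
rewrite mulr0 subr0 addr_ge0// mulr_ge0 ?expR_ge0 ?sqr_ge0//.
by rewrite mulr_ge0 ?sqr_ge0// ltW.
Qed.

(** The matrix of the system has zero trace. *)
Lemma sys_wronskian V E y1 th1 y2 th2 (x z : R) :
  hom V E y1 th1 -> hom V E y2 th2 ->
  y1 x * th2 x - th1 x * y2 x = y1 z * th2 z - th1 z * y2 z.
Proof.
move=> [dy1 dth1] [dy2 dth2].
apply: (@isd_eq0_eq _ (fun x => y1 x * th2 x - th1 x * y2 x) (fun=> 0)) => // w.
by der (first [exact: dy1 | exact: dy2 | exact: dth1 | exact: dth2]); ring.
Qed.

Lemma continuous_pos_itv (h : R -> R) (a b : R) : continuous h -> a <= b ->
  0 < h a -> (forall x, a <= x -> h x != 0) -> 0 < h b.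
Proof.
move=> ch ab ha h0; rewrite ltNge; apply/negP => hb.
have [||c] := @IVT R h a b 0 ab.
- exact: continuous_subspaceT.
- by rewrite ge_min hb orbT le_max (ltW ha).
- by rewrite in_itv/= => /andP[/h0 + _] => /[swap] ->; rewrite eqxx.
Qed.

(** [y1 = o(y2)] at +oo; the strict inequality also forces [y2] to be nonzero far out. *)
Definition dominated (y1 y2 : R -> R) : Prop :=
  forall e, 0 < e -> exists X, forall x, X < x -> `|y1 x| < e * `|y2 x|.

(** If [y1 * th1 > 0] at [x], then for small [e] the solutions [y1 + e y2] and [y1 - e y2] also have
    a positive product with their own [th] at [x], hence on all of [[x, +oo[] by monotonicity, so
    that neither vanishes there. Thus [y1^2 - e^2 y2^2] stays positive, against the domination. *)
Lemma dominated_sys_prod_le0 V E y1 th1 y2 th2 : (forall x, 0 < E x) ->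
  hom V E y1 th1 -> hom V E y2 th2 -> dominated y1 y2 ->
  forall x, y1 x * th1 x <= 0.
Proof.
move=> E0 h1 h2 y12 x; rewrite leNgt; apply/negP => p0.
have [a0 b0] : y1 x != 0 /\ th1 x != 0.
  by split; apply: contraTneq p0 => ->; rewrite ?mul0r ?mulr0 ltxx.
(* [e] is so small that adding [d * y2] and [d * th2] with [|d| = e] changes neither the sign of
   [y1] nor that of [th1] at [x]; the denominators carry [+ 1] because [y2 x] or [th2 x] may be
   0. *)
have [e [e0 ec ed]] : exists e, [/\ 0 < e, e * `|y2 x| < `|y1 x| &
    e * `|th2 x| < `|th1 x|].
  have c1 : 0 < `|y2 x| + 1 by rewrite ltr_wpDl.
  have d1 : 0 < `|th2 x| + 1 by rewrite ltr_wpDl.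
  exists (Num.min (`|y1 x| / (`|y2 x| + 1)) (`|th1 x| / (`|th2 x| + 1))); split.
  - by rewrite lt_min !divr_gt0 ?normr_gt0.
  - apply: (@le_lt_trans _ _ (`|y1 x| / (`|y2 x| + 1) * `|y2 x|)).
      by rewrite ler_wpM2r// ge_min lexx.
    by rewrite mulrAC ltr_pdivrMr// ltr_pM2l ?normr_gt0// ltrDl.
  - apply: (@le_lt_trans _ _ (`|th1 x| / (`|th2 x| + 1) * `|th2 x|)).
      by rewrite ler_wpM2r// ge_min lexx orbT.
    by rewrite mulrAC ltr_pdivrMr// ltr_pM2l ?normr_gt0// ltrDl.
have key d : `|d| = e -> forall z, x <= z -> 1 * y1 z + d * y2 z != 0.
  move=> de z xz; have h := sys_lin 1 d h1 h2.
  have := sys_prod_le E0 h xz.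
  suff q0 : 0 < (1 * y1 x + d * y2 x) * (1 * th1 x + d * th2 x).
    by move=> /(lt_le_trans q0); apply: contraTneq => ->; rewrite mul0r ltxx.
  have : `|d * y2 x| < `|y1 x| by rewrite normrM de.
  have : `|d * th2 x| < `|th1 x| by rewrite normrM de.
  rewrite !mul1r; move: (d * y2 x) (d * th2 x) => u v.
  rewrite !ltr_norml; move: p0; have [A|A|A] := ltgtP (y1 x) 0.
  - by have [B|B|B] := ltgtP (th1 x) 0; rewrite ?(ltr0_norm A) ?(ltr0_norm B); nra.
  - by have [B|B|B] := ltgtP (th1 x) 0; rewrite ?(gtr0_norm A) ?(gtr0_norm B); nra.
  - by rewrite A mul0r ltxx.
have [X yX] := y12 e e0.
pose z := Num.max (X + 1) x.
have Xz : X < z by rewrite lt_max ltrDl ltr01.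
have xz : x <= z by rewrite le_max lexx orbT.
have cy : continuous (fun w => (1 * y1 w + e * y2 w) * (1 * y1 w + - e * y2 w)).
  exact: (isd_continuous (fun w => isdM ((sys_lin 1 e h1 h2).1 w)
    ((sys_lin 1 (- e) h1 h2).1 w))).
have sq w : (1 * y1 w + e * y2 w) * (1 * y1 w + - e * y2 w) =
   `|y1 w| ^+ 2 - (e * `|y2 w|) ^+ 2.
  by rewrite exprMn !real_normK ?num_real//; ring.
have := continuous_pos_itv cy xz.
rewrite !sq subr_gt0 ltr_pXn2r ?nnegrE ?mulr_ge0 ?(ltW e0)// => /(_ ec).
have -> : 0 < `|y1 z| ^+ 2 - (e * `|y2 z|) ^+ 2 = false.
  apply/negbTE; rewrite -leNgt subr_le0 ler_pXn2r ?nnegrE ?mulr_ge0 ?(ltW e0)//.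
  exact: ltW (yX z Xz).
move=> H; suff : false by [].
by apply: H => w xw; rewrite mulf_neq0//; apply: key => //; rewrite ?normrN gtr0_norm.
Qed.

(** The derivatives of [y^2] and [th^2] are nonnegative multiples of [y * th]. *)
Lemma sys_prod_le0_noninc V E y th (x z : R) : (forall x, 0 < E x) ->
  hom V E y th -> (forall w, x < w < z -> y w * th w <= 0) -> x <= z ->
  `|y z| <= `|y x| /\ `|th z| <= `|th x|.
Proof.
move=> E0 [dy dth] p0 xz.
split; rewrite -(@ler_pXn2r _ 2) ?nnegrE// !real_normK ?num_real//.
- apply: (@isd_le0_ge _ (fun x => y x ^+ 2)
    (fun x => 2 * expR (V x) * (y x * th x))) => // w.
    by der (exact: dy); ring.
  by move=> /p0 pw; rewrite mulr_ge0_le0// mulr_ge0 ?expR_ge0.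
- apply: (@isd_le0_ge _ (fun x => th x ^+ 2)
    (fun x => 2 * E x * expR (- V x) * (y x * th x))) => // w.
    by der (exact: dth); ring.
  by move=> /p0 pw; rewrite mulr_ge0_le0// mulr_ge0 ?expR_ge0// mulr_ge0// ltW.
Qed.

Definition bounded_below_right V : Prop := exists X c, forall x, X <= x -> c <= V x.

(** Since [|th|] is nonincreasing, failure would mean [|th| >= e] everywhere; then, to the right of
    [X], [y * th] would grow at rate at least [k = expR c * e ^+ 2] and become positive. *)
Lemma sys_decay V E y th : (forall x, 0 < E x) -> bounded_below_right V ->
  hom V E y th -> (forall x, y x * th x <= 0) ->
  forall e, 0 < e -> exists X, forall x, X < x -> `|th x| < e.
Proof.
move=> E0 [X [c Vc]] h p0 e e0; apply: contrapT => /forallNP H.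
have big x : e <= `|th x|.
  have /existsNP[z /not_implyP[xz /negP]] := H x; rewrite -leNgt => /le_trans; apply.
  by have [] := @sys_prod_le0_noninc V E y th x z E0 h (fun w _ => p0 w) (ltW xz).
pose k := expR c * e ^+ 2.
have k0 : 0 < k by rewrite mulr_gt0 ?expR_gt0 ?exprn_gt0.
pose p x := y x * th x.
(* The point where growth at rate [k] brings [y * th] from [p X] up to 1. *)
pose Z := X + (1 - p X) / k.
have XZ : X <= Z by rewrite lerDl divr_ge0 ?(ltW k0)// subr_ge0 (le_trans (p0 X)).
have : p X - k * X <= p Z - k * Z.
  apply: (@isd_ge0_le _ (fun x => p x - k * x) (fun x => expR (V x) * th x ^+ 2 +
    expR (- V x) * (E x * y x ^+ 2 - y x * 0) - k)) => // w.
    by der (exact: sys_prod h); ring.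
  move=> /andP[Xw _]; rewrite mulr0 subr0 addrAC addr_ge0//.
    rewrite subr_ge0 /k -[th w ^+ 2]real_normK ?num_real//.
    apply: ler_pM; rewrite ?expR_ge0 ?sqr_ge0 ?ler_expR ?Vc ?(ltW Xw)//.
    by rewrite ler_pXn2r ?nnegrE ?(ltW e0).
  by rewrite mulr_ge0 ?expR_ge0// mulr_ge0 ?sqr_ge0 ?ltW.
have := p0 Z; rewrite -/(p Z).
have : k * (Z - X) = 1 - p X by rewrite /Z [X + _]addrC addrK mulrC divfK// gt_eqF.
by rewrite mulrBr; lra.
Qed.

(** Either [y2 * th2] is positive somewhere, and from there on [|th2|] is nondecreasing while [th1]
    tends to 0; or both products are nonpositive, so that [y1], [y2] stay bounded on the right while
    [th1], [th2] tend to 0, and the constant Wronskian would be 0. *)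
Lemma sys_dominated V E y1 th1 y2 th2 : (forall x, 0 < E x) ->
  bounded_below_right V -> hom V E y1 th1 -> hom V E y2 th2 ->
  (forall x, y1 x * th2 x - th1 x * y2 x != 0) -> dominated y1 y2 ->
  dominated th1 th2.
Proof.
move=> E0 Vb h1 h2 W y12.
have p1 := dominated_sys_prod_le0 E0 h1 h2 y12.
have th10 := sys_decay E0 Vb h1 p1.
have [[x0 p2]|np2] := pselect (exists x, 0 < y2 x * th2 x).
  have th20 : 0 < `|th2 x0|.
    by rewrite normr_gt0; apply: contraTneq p2 => ->; rewrite mulr0 ltxx.
  move=> e e0; have [X thX] := th10 _ (mulr_gt0 e0 th20).
  exists (Num.max X x0) => x; rewrite gt_max => /andP[/thX thx xx0].
  apply: (lt_le_trans thx); rewrite ler_wpM2l ?(ltW e0)//.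
  rewrite -(@ler_pXn2r _ 2) ?nnegrE// !real_normK ?num_real//.
  apply: (@isd_ge0_le _ (fun x => th2 x ^+ 2)
    (fun x => 2 * E x * expR (- V x) * (y2 x * th2 x))) => //.
  - by move=> w; der (exact: h2.2); ring.
  - exact: ltW.
  - move=> w /andP[xw _]; apply: mulr_ge0; first by rewrite !mulr_ge0 ?expR_ge0// ltW.
    by rewrite (le_trans (ltW p2))//; apply: (sys_prod_le E0 h2); exact: ltW.
have p2 x : y2 x * th2 x <= 0 by rewrite leNgt; apply/negP => p; apply: np2; exists x.
have th20 := sys_decay E0 Vb h2 p2.
pose C := `|y1 0| + `|y2 0| + 1.
have C0 : 0 < C by rewrite ltr_wpDl// addr_ge0.
pose w := `|y1 0 * th2 0 - th1 0 * y2 0|.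
have w0 : 0 < w by rewrite normr_gt0.
have wC : 0 < w / C by rewrite divr_gt0.
have [X1 thX1] := th10 _ wC; have [X2 thX2] := th20 _ wC.
pose z := Num.max 0 (Num.max X1 X2) + 1.
have z0 : 0 <= z by rewrite addr_ge0// le_max lexx.
have {}thX1 : `|th1 z| < w / C.
  by apply: thX1; rewrite ltr_pwDr// !le_max lexx orbT.
have {}thX2 : `|th2 z| < w / C.
  by apply: thX2; rewrite ltr_pwDr// !le_max lexx !orbT.
have [y1z _] := sys_prod_le0_noninc E0 h1 (fun w _ => p1 w) z0.
have [y2z _] := sys_prod_le0_noninc E0 h2 (fun w _ => p2 w) z0.
have : w <= w / C * (`|y1 0| + `|y2 0|).
  rewrite {1}/w (sys_wronskian 0 z h1 h2).
  rewrite (le_trans (ler_normB _ _))// !normrM mulrDr lerD//.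
    by rewrite mulrC ler_pM// ltW.
  by rewrite ler_pM// ltW.
rewrite mulrAC ler_pdivlMr// ler_pM2l// /C; lra.
Qed.

(** Carries the study of -oo back to +oo; [th] changes sign because it contains a derivative of
    [y]. *)
Lemma sys_reflect V E F y th : sys V E F y th ->
  sys (fun x => V (- x)) (fun x => E (- x)) (fun x => F (- x))
    (fun x => y (- x)) (fun x => - th (- x)).
Proof.
move=> [dy dth]; split=> x.
  by apply: isd_eq; [exact: isd_opp (dy _)|ring].
by apply: isd_eq; [apply: isdN; exact: isd_opp (dth _)|ring].
Qed.

(* With [s = E^(-1/2)] and [t = E^(1/2)], the derivative of a solution satisfies,
   after multiplication by [s], the equation of the next rank. *)
Lemma sys_next V E F y th (V1 V2 s s1 s2 t F1 : R -> R) :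
  (forall x, isd x V (V1 x)) -> (forall x, isd x V1 (V2 x)) ->
  (forall x, isd x s (s1 x)) -> (forall x, isd x s1 (s2 x)) ->
  (forall x, isd x t (- (t x ^+ 2 * s1 x))) -> (forall x, t x * s x = 1) ->
  (forall x, E x = t x ^+ 2) -> (forall x, isd x F (F1 x)) -> sys V E F y th ->
  sys V (fun x => t x ^+ 2 + t x * (s2 x + V1 x * s1 x + s x * V2 x))
    (fun x => 2 * s1 x * F x + s x * F1 x)
    (fun x => s x * expR (V x) * th x)
    (fun x => (s1 x + s x * V1 x) * th x +
              expR (- V x) * (t x * y x - s x * F x)).
Proof.
move=> dV dV1 ds ds1 dt ts Et dF [dy dth].
have t0 x : t x != 0.
  by apply/eqP => t0; have := ts x; rewrite t0 mul0r => /esym/eqP; rewrite oner_eq0.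
have sx x : s x = (t x)^-1 by rewrite -[RHS]mulr1 -(ts x) mulKf.
split=> x.
  der (first [exact: ds | exact: dV | exact: dth]).
  by rewrite Et sx expRN; field; rewrite t0 expR_eq0.
der (first [exact: ds | exact: ds1 | exact: dt | exact: dV | exact: dV1 |
            exact: dth | exact: dy | exact: dF]).
by rewrite Et sx expRN; field; rewrite t0 expR_eq0.
Qed.

End System.

(** * The probability measure with density [expR (- V x)] *)

Lemma continuous_measurableT (R : realType) (f : R -> R) : continuous f ->
  measurable_fun [set: measurableTypeR R] f.
Proof. exact: continuous_measurable_fun. Qed.

Section Density.
Context {R : realType} (V : R -> R) (mu : probability (measurableTypeR R) R).
Hypothesis cV : continuous V.
Hypothesis muE : forall A : set (measurableTypeR R), measurable A ->
  mu A = (\int[lebesgue_measure]_(x in A) (expR (- V x))%:E)%E.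

Local Notation leb := (@lebesgue_measure R).

Lemma continuous_density : continuous (fun x => expR (- V x)).
Proof.
by apply: (@class_C_continuous _ 0); apply: class_C_expR; apply: class_CN;
  exact/class_C0.
Qed.

Lemma measurable_density : measurable_fun [set: measurableTypeR R]
  (fun x => (expR (- V x))%:E).
Proof.
apply/measurable_EFinP; apply: continuous_measurableT; exact: continuous_density.
Qed.

Lemma density_dominates : mu `<< leb.
Proof.
apply/null_content_dominatesP => A mA A0; rewrite muE//.
apply: null_set_integral => //.
exact: measurable_funTS measurable_density.
Qed.

(** [muE] only gives the measure of sets; the passage to integrals goes through the Radon-Nikodym
    derivative, which agrees almost everywhere with [expR (- V x)]. *)
Lemma integral_density (f : R -> \bar R) (U : set (measurableTypeR R)) :
  measurable U -> mu.-integrable U f ->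
  (\int[mu]_(x in U) f x = \int[leb]_(x in U) (f x * (expR (- V x))%:E))%E.
Proof.
move=> mU intf.
rewrite -(Radon_Nikodym_change_of_variables density_dominates mU intf).
have mf := measurable_int _ intf.
have iRN : leb.-integrable [set: R]
    (Radon_Nikodym (charge_of_finite_measure mu) leb).
  by apply: Radon_Nikodym_integrable; exact: density_dominates.
apply: ae_eq_integral => //.
- apply: emeasurable_funM => //; apply: measurable_funTS.
  exact: measurable_int iRN.
- by apply: emeasurable_funM => //; exact: measurable_funTS measurable_density.
- apply: ae_eqe_mul2l; apply: integral_ae_eq => //.
  + exact: integrableS iRN.
  + exact: measurable_funTS measurable_density.
  + move=> A AU mA; rewrite -Radon_Nikodym_integral//; last exact: density_dominates.
    exact: muE.
Qed.

Lemma integrable_density : leb.-integrable [set: R] (fun x => (expR (- V x))%:E).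
Proof.
apply/integrableP; split; first exact: measurable_density.
under eq_integral do rewrite gee0_abs ?lee_fin ?expR_ge0//.
by rewrite -muE// probability_setT ltry.
Qed.

Lemma bounded_integrable (h : R -> R) (M : R) (A : set (measurableTypeR R)) :
  measurable A -> continuous h -> (forall x, A x -> `|h x| <= M) ->
  mu.-integrable A (EFin \o h).
Proof.
move=> mA ch hM; apply: measurable_bounded_integrable => //.
- by rewrite (le_lt_trans (probability_le1 _ mA))// ltry.
- by apply: measurable_funTS; exact: continuous_measurableT.
- exists M; split; first exact: num_real.
  by move=> y My x Ax; apply: (le_trans (hM x Ax)); exact: ltW.
Qed.

Lemma itv_integrable (h : R -> R) (a b : R) : continuous h ->
  mu.-integrable `[a, b]%classic (EFin \o h).
Proof.
move=> ch; have [M M0 hM] := continuous_bounded_segment (Num.max `|a| `|b|) ch.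
apply: (@bounded_integrable _ M) => // x /=; rewrite in_itv/= => /andP[ax xb].
apply: hM; rewrite le_max !ler_norml; have := ler_norm b; have := ler_norm (- a).
rewrite normrN; have [x0|x0] := leP 0 x => A B.
  by apply/orP; right; apply/andP; split; lra.
by apply/orP; left; apply/andP; split; lra.
Qed.

Lemma supported_integrable (h : R -> R) (K : R) (A : set (measurableTypeR R)) :
  measurable A -> continuous h -> supported K h -> mu.-integrable A (EFin \o h).
Proof.
move=> mA ch hK; have [M M0 hM] := supported_bounded ch hK.
exact: (@bounded_integrable _ M).
Qed.

Lemma isd_oo_LRcontinuous (P p : R -> R) (a b : R) : (forall x, isd x P (p x)) ->
  derivable_oo_LRcontinuous P a b.
Proof.
move=> dP; have cP := isd_continuous dP; split.
- by move=> x _; exact: isd_derivable (dP x).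
- by apply: cvg_at_right_filter; exact: cP.
- by apply: cvg_at_left_filter; exact: cP.
Qed.

(** The factor [expR (V x)] cancels the density, so boundary terms appear without weight.
    Integrations by parts go through this form, or through [mu_int_deriv0] when the boundary terms
    vanish. *)
Lemma mu_FTC (P p : R -> R) (a b : R) : a < b -> (forall x, isd x P (p x)) ->
  continuous p ->
  (\int[mu]_(x in `[a, b]) (p x * expR (V x))%:E = (P b - P a)%:E)%E.
Proof.
move=> ab dP cp.
have cpV : continuous (fun x => p x * expR (V x)).
  by apply/class_C0/class_CM; [exact/class_C0|apply: class_C_expR; exact/class_C0].
rewrite integral_density//; last exact: itv_integrable.
under eq_integral do rewrite -EFinM -mulrA -expRD subrr expR0 mulr1.
rewrite (continuous_FTC2 ab _ (isd_oo_LRcontinuous a b dP))//.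
- exact: continuous_subspaceT.
- by move=> x _; exact: isd_val.
Qed.

Lemma Rintegral_supported (h : R -> R) (K : R) (a b : R) : supported K h ->
  a <= - K -> K <= b -> \int[mu]_x h x = \int[mu]_(x in `[a, b]) h x.
Proof.
move=> hK aK Kb; rewrite [RHS]Rintegral_mkcond; apply: eq_Rintegral => x _.
rewrite patchE; case: ifPn => // /negP; rewrite inE/= in_itv/= => /negP xab.
apply: hK; move: xab; rewrite negb_and -!ltNge => /orP[xa|bx].
  by rewrite lter_normr; apply/orP; right; lra.
by rewrite lter_normr; apply/orP; left; lra.
Qed.

Lemma mu_int_deriv0 (P p : R -> R) (K : R) : (forall x, isd x P (p x)) ->
  continuous p -> supported K P -> \int[mu]_x (p x * expR (V x)) = 0.
Proof.
move=> dP cp PK; have pK := supported_isd dP PK.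
pose L := `|K| + 1.
have KL : K < L by rewrite (le_lt_trans (ler_norm K))// ltrDl.
have L0 : 0 < L by rewrite ltr_wpDl.
rewrite (@Rintegral_supported _ K (- L) L) ?(ltW KL)//; last first.
- by rewrite lerN2 ltW.
- exact: supportedMl.
rewrite /Rintegral (mu_FTC _ dP cp)/=; last by lra.
by rewrite !PK ?subrr// ?normrN gtr0_norm.
Qed.

Definition cumul (x : R) : R := fine (mu `]-oo, x]%classic).

Lemma isd_cumul x : isd x cumul (expR (- V x)).
Proof.
have x1 : x < x + 1 by rewrite ltrDl.
have intf : leb.-integrable `]-oo, (x + 1)] (EFin \o (fun y => expR (- V y))).
  exact: integrableS integrable_density.
have [df <-] := continuous_FTC1 x1 intf (ltNyr _) (@continuous_density x).
rewrite (_ : cumul = (fun x => \int[leb]_(t in `]-oo, x]) expR (- V t))).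
  exact: isd_derive1.
by apply/funext => y; rewrite /cumul muE.
Qed.

(** The identity as a random variable, so that the limits of a distribution function apply to
    [cumul]. *)
Let idTR : measurableTypeR R -> R := idfun.

#[local] HB.instance Definition _ :=
  @isMeasurableFun.Build _ _ _ _ idTR (@measurable_id _ _ setT).

Lemma cumulE x : cdf (idTR : {RV mu >-> R}) x = (cumul x)%:E.
Proof. by rewrite /cumul fineK ?fin_num_measure. Qed.

Lemma cumul_cvgy e : 0 < e -> exists X, forall x, X < x -> `|1 - cumul x| < e.
Proof.
move=> e0; have := cvg_cdfy1 (idTR : {RV mu >-> R}).
rewrite (_ : cdf _ = fun x => (cumul x)%:E); last first.
  by apply/funext => x; exact: cumulE.
move=> /fine_cvgP[_] /cvgrPdist_lt /(_ e e0)[X [_ HX]].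
by exists X => x /HX.
Qed.

Lemma cumul_cvgNy e : 0 < e -> exists X, forall x, x < X -> `|cumul x| < e.
Proof.
move=> e0; have := cvg_cdfNy0 (idTR : {RV mu >-> R}).
rewrite (_ : cdf _ = fun x => (cumul x)%:E); last first.
  by apply/funext => x; exact: cumulE.
move=> /fine_cvgP[_] /cvgrPdist_lt /(_ e e0)[X [_ HX]].
by exists X => x /HX /=; rewrite sub0r normrN.
Qed.

Lemma cumul_le1 x : cumul x <= 1.
Proof.
by rewrite -lee_fin /cumul fineK ?fin_num_measure// probability_le1.
Qed.

Lemma cumul_ge0 x : 0 <= cumul x.
Proof. by rewrite fine_ge0. Qed.

End Density.

(** * Semi-inner products and [L^2] *)

Lemma eq_cvgn (R : realType) (u v : nat -> R) (l : R) : u =1 v ->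
  v k @[k --> \oo] --> l -> u k @[k --> \oo] --> l.
Proof. by move=> /funext ->. Qed.

Lemma discriminant_le (R : realType) (a b c : R) : 0 <= c ->
  (forall t, 0 <= a + 2 * t * b + t ^+ 2 * c) -> b ^+ 2 <= a * c.
Proof.
rewrite le_eqVlt => /predU1P[<-|c0] H.
  rewrite mulr0; have [->|b0] := eqVneq b 0; first by rewrite expr0n.
  (* This value of [t] would make the affine polynomial equal to -1. *)
  have := H (- (a + 1) / (2 * b)).
  rewrite mulr0 addr0 (_ : 2 * _ * b = - (a + 1)); last by field; rewrite b0.
  by lra.
have := H (- b / c).
rewrite (_ : a + _ + _ = (a * c - b ^+ 2) / c); last by field; rewrite gt_eqF.
by rewrite pmulr_lge0 ?invr_gt0// subr_ge0.
Qed.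

(** The laws are restricted to a subspace [D] because additivity of the integral requires
    integrability. The two instances are [L^2] with its inner product, and test functions with the
    polarised form. *)
Record semi_inner (R : realType) (D : set (R -> R))
    (B : (R -> R) -> (R -> R) -> R) : Prop := SemiInner {
  si_addc : forall u v, D u -> D v -> D (u \+ v);
  si_scalec : forall a u, D u -> D (fun x => a * u x);
  si_add : forall u v w, D u -> D v -> D w -> B (u \+ v) w = B u w + B v w;
  si_scale : forall a u w, D u -> D w -> B (fun x => a * u x) w = a * B u w;
  si_sym : forall u v, D u -> D v -> B u v = B v u;
  si_ge0 : forall u, D u -> 0 <= B u u }.

Section SemiInnerTheory.
Context {R : realType} {D : set (R -> R)} {B : (R -> R) -> (R -> R) -> R}.
Hypothesis S : semi_inner D B.

Lemma sub_funE (u v : R -> R) : u \- v = u \+ (fun x => -1 * v x).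
Proof. by apply/funext => x /=; rewrite mulN1r. Qed.

Lemma si_subc u v : D u -> D v -> D (u \- v).
Proof.
by move=> Du Dv; rewrite sub_funE; apply: (si_addc S) => //; exact: (si_scalec S).
Qed.

Lemma si_subl u v w : D u -> D v -> D w -> B (u \- v) w = B u w - B v w.
Proof.
move=> Du Dv Dw; rewrite sub_funE (si_add S)//; last exact: (si_scalec S).
by rewrite (si_scale S)// mulN1r.
Qed.

Lemma si_subr u v w : D u -> D v -> D w -> B w (u \- v) = B w u - B w v.
Proof.
move=> Du Dv Dw; have Duv := si_subc Du Dv.
by rewrite (si_sym S)// si_subl// !(si_sym S Dw).
Qed.

Lemma si_addr u v w : D u -> D v -> D w -> B w (u \+ v) = B w u + B w v.
Proof.
move=> Du Dv Dw; have Duv := si_addc S Du Dv.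
by rewrite (si_sym S)// (si_add S)// !(si_sym S Dw).
Qed.

Lemma si_scaler a u w : D u -> D w -> B w (fun x => a * u x) = a * B w u.
Proof.
move=> Du Dw; have Dau := si_scalec S a Du.
by rewrite (si_sym S)// (si_scale S)// (si_sym S Dw).
Qed.

Lemma si_CS u v : D u -> D v -> B u v ^+ 2 <= B u u * B v v.
Proof.
move=> Du Dv; apply: discriminant_le; first exact: (si_ge0 S).
move=> t; have Dtv := si_scalec S t Dv; have Dw := si_addc S Du Dtv.
have := si_ge0 S Dw; rewrite (si_add S Du Dtv Dw) (si_addr Du Dtv Du).
rewrite (si_addr Du Dtv Dtv) (si_scaler _ Dv Du) (si_scale S _ Dv Du).
rewrite (si_scale S _ Dv Dtv) (si_scaler _ Dv Dv) (si_sym S Dv Du).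
by congr (_ <= _); ring.
Qed.

Lemma si_bound u v d M : D u -> D v -> 0 < d -> 0 < M -> B u u <= d ^+ 2 / M ->
  B v v <= M -> `|B u v| <= d.
Proof.
move=> Du Dv d0 M0 Bu Bv; rewrite -(@ler_pXn2r _ 2) ?nnegrE ?(ltW d0)//.
rewrite real_normK ?num_real// (le_trans (si_CS Du Dv))//.
rewrite -[leRHS](@divfK _ M) ?gt_eqF//.
by rewrite ler_pM// (si_ge0 S).
Qed.

Lemma si_add_le u v : D u -> D v -> B (u \+ v) (u \+ v) <= 2 * B u u + 2 * B v v.
Proof.
move=> Du Dv; have Duv := si_addc S Du Dv.
have Dw := si_subc Du Dv.
have := si_ge0 S Dw; rewrite (si_subl Du Dv Dw) (si_subr Du Dv Du) (si_subr Du Dv Dv).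
rewrite (si_add S Du Dv Duv) (si_addr Du Dv Du) (si_addr Du Dv Dv) (si_sym S Dv Du).
by lra.
Qed.

Lemma si_opp u : D u -> B (fun x => -1 * u x) (fun x => -1 * u x) = B u u.
Proof.
by move=> Du; have := si_scalec S (-1) Du => Dv; rewrite (si_scale S)// si_scaler// !mulN1r opprK.
Qed.

End SemiInnerTheory.

Section L2space.
Context {R : realType} (mu : {measure set (measurableTypeR R) -> \bar R}).
Implicit Types f g h : R -> R.
Local Notation L2 := [set f | f \in Lfun mu 2%:E].

Lemma L2_sqr_integrable f : L2 f -> mu.-integrable setT (EFin \o (fun x => f x ^+ 2)).
Proof. exact: Lfun2_integrable_sqr. Qed.

Lemma Lnorm2E f : ('N[mu]_2%:E [EFin \o f] =
  (\int[mu]_x (f x ^+ 2)%:E) `^ 2^-1)%E.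
Proof.
rewrite unlock; congr (_ `^ _)%E; apply: eq_integral => x _ /=.
by rewrite -(real_normK (num_real (f x))) -powR_mulrn.
Qed.

Lemma L2P f : measurable_fun [set: measurableTypeR R] f ->
  mu.-integrable setT (EFin \o (fun x => f x ^+ 2)) -> L2 f.
Proof.
move=> mf /integrableP[_ fi]; rewrite /= inE; apply/andP; split; first by rewrite inE.
rewrite inE /= /finite_norm Lnorm2E; apply: poweR_lty.
apply: le_lt_trans fi; rewrite le_eqVlt; apply/orP; left; apply/eqP/eq_integral => x _ /=.
by rewrite ger0_norm ?sqr_ge0.
Qed.

Lemma L2_mul_integrable f g : L2 f -> L2 g ->
  mu.-integrable setT (EFin \o (fun x => f x * g x)).
Proof. by move=> Lf Lg; apply/Lfun1_integrable; exact: Lfun2_mul_Lfun1. Qed.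

Lemma Lnorm2_fin f : L2 f ->
  ('N[mu]_2%:E [EFin \o f] = (Num.sqrt (L2inner mu f f))%:E)%E.
Proof.
move=> /L2_sqr_integrable fi; rewrite Lnorm2E -(fineK (integrable_fin_num _ fi))//=.
rewrite powR12_sqrt; last by apply: fine_ge0; apply: integral_ge0 => x _; rewrite lee_fin sqr_ge0.
by [].
Qed.

Lemma L2_semi_inner : semi_inner L2 (L2inner mu).
Proof.
split.
- move=> u v Lu Lv.
  have p1 : (1 <= 2%:E :> \bar R)%E by rewrite lee_fin ler1n.
  by case: (@Lfun_addr_closed _ _ _ mu _ p1) => _; apply.
- move=> a u Lu /=; rewrite (_ : (fun x => _) = a \o* u); last first.
    by apply/funext => x /=; rewrite mulrC.
  by apply: Lfun_scale => //; rewrite ler1n.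
- move=> u v w Lu Lv Lw; rewrite /L2inner -RintegralD//; try exact: L2_mul_integrable.
  by apply: eq_Rintegral => x _; rewrite mulrDl.
- move=> a u w Lu Lw; rewrite /L2inner -RintegralZl//; last exact: L2_mul_integrable.
  by apply: eq_Rintegral => x _; rewrite mulrA.
- by move=> u v _ _; apply: eq_Rintegral => x _; rewrite mulrC.
- by move=> u _; apply: Rintegral_ge0 => x _; rewrite -expr2 sqr_ge0.
Qed.

Lemma Lnorm2_cvg0 (f_ : nat -> R -> R) : (forall k, L2 (f_ k)) ->
  ('N[mu]_2%:E [EFin \o f_ k])%E @[k --> \oo] --> 0%E <->
  L2inner mu (f_ k) (f_ k) @[k --> \oo] --> 0.
Proof.
move=> Lf; under eq_fun do rewrite Lnorm2_fin//.
have B0 k := si_ge0 L2_semi_inner (Lf k).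
split=> [/fine_cvgP[_ /= cf]|cf].
  have := cvgM cf cf; rewrite mulr0 => /(_ _); apply: eq_cvgn => k /=.
  by rewrite -expr2 sqr_sqrtr.
apply: cvg_EFin; first exact: nearW.
have : Num.sqrt (L2inner mu (f_ k) (f_ k)) @[k --> \oo] --> Num.sqrt 0.
  by apply: continuous_cvg; [exact: sqrt_continuous|exact: cf].
by rewrite sqrtr0.
Qed.

End L2space.

(** * Closure of a quadratic form and its operator *)

Section FormTheory.
Context {R : realType} (mu : {measure set (measurableTypeR R) -> \bar R}).
Variables (C : set (R -> R)) (q : (R -> R) -> R) (B : (R -> R) -> (R -> R) -> R).
Hypothesis S : semi_inner C B.
Hypothesis qB : forall u, C u -> q u = B u u.
Local Notation L2 := [set f | f \in Lfun mu 2%:E].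
Hypothesis CL2 : C `<=` L2.

(* [w] represents the functional [B ^~ v]: [v] lies in the domain of the
   operator with image [w] *)
Definition represents (v w : R -> R) := forall u, C u -> B u v = L2inner mu u w.

Hypothesis reprC : forall v, C v -> exists2 w, L2 w & represents v w.

Let SL := L2_semi_inner mu.

Lemma form_approx_near (u_ : nat -> R -> R) (u : R -> R) : L2 u ->
  form_approx mu C q u_ u ->
  [/\ forall k, C (u_ k),
      forall e, 0 < e -> exists N, forall k, (N <= k)%N ->
        L2inner mu (u_ k \- u) (u_ k \- u) < e,
      forall e, 0 < e -> exists N, forall k m, (N <= k)%N -> (N <= m)%N ->
        B (u_ k \- u_ m) (u_ k \- u_ m) < e &
      exists2 M, 0 < M & exists N, forall k, (N <= k)%N -> B (u_ k) (u_ k) <= M].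
Proof.
move=> Lu [Cu Nu qu].
have qu' e : 0 < e -> exists N, forall k m, (N <= k)%N -> (N <= m)%N ->
    B (u_ k \- u_ m) (u_ k \- u_ m) < e.
  move=> /qu[N HN]; exists N => k m Nk Nm; rewrite -qB; first exact: HN.
  by apply: (si_subc S).
split => //.
  move=> e e0; have Ld k : L2 (u_ k \- u) by apply: (si_subc SL) => //; exact: CL2.
  have /(Lnorm2_cvg0 Ld) /cvgrPdist_lt /(_ e e0)[N _ HN] := Nu.
  exists N => k /HN; rewrite sub0r normrN; apply: le_lt_trans; exact: ler_norm.
have [N HN] := qu' 1 ltr01.
exists (2 + 2 * B (u_ N) (u_ N)).
  by rewrite ltr_wpDr// mulr_ge0// (si_ge0 S).
exists N => k Nk; have -> : u_ k = (u_ k \- u_ N) \+ u_ N.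
  by apply/funext => x /=; rewrite subrK.
apply: (le_trans (si_add_le S _ _)) => //; first exact: (si_subc S).
by rewrite lerD2r -[leRHS]mulr1 ler_pM2l// ltW// HN.
Qed.

(** For a fixed [v_ m] with representative [a], [B (u_ k) (v_ m)] is [L2inner mu (u_ k) a], which
    tends to [L2inner mu u a = L2inner mu w (v_ m)]. Replacing [v_ m] by [v_ k] costs little,
    because [v_] is Cauchy for the form and [u_] is bounded for it. *)
Lemma form_weak_limit (u_ v_ : nat -> R -> R) (u v w : R -> R) :
  L2 u -> L2 v -> L2 w -> form_approx mu C q u_ u -> form_approx mu C q v_ v ->
  (forall phi, C phi -> exists a,
    [/\ L2 a, represents phi a & L2inner mu u a = L2inner mu w phi]) ->
  B (u_ k) (v_ k) @[k --> \oo] --> L2inner mu w v.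
Proof.
move=> Lu Lv Lw /(form_approx_near Lu)[Cu uu _ [M M0 [N0 uM]]].
move=> /(form_approx_near Lv)[Cv vv vC _] uw.
have LCu k := CL2 (Cu k); have LCv k := CL2 (Cv k).
apply/cvgrPdist_le => e e0.
have e3 : 0 < e / 3 by rewrite divr_gt0.
pose K f := L2inner mu f f + 1.
have K0 f : L2 f -> 0 < K f by move=> Lf; rewrite ltr_wpDl// (si_ge0 SL).
have KP f : L2inner mu f f <= K f by rewrite lerDl.
have d0 f : L2 f -> 0 < (e / 3) ^+ 2 / K f.
  by move=> /K0 ?; rewrite divr_gt0 ?exprn_gt0.
have [N1 HN1] := vC _ (divr_gt0 (exprn_gt0 2 e3) M0).
have [N2 HN2] := vv _ (d0 _ Lw).
(* [m] is fixed before [k] grows, since the representative [a] and the rank [N3] depend on it. *)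
pose m := maxn N1 N2.
have [a [La va uva]] := uw _ (Cv m).
have [N3 HN3] := uu _ (d0 _ La).
exists (maxn N0 (maxn N1 N3)) => // k /=; rewrite !geq_max => /and3P[k0 k1 k3].
have Lvm : L2 (v_ m \- v) by exact: (si_subc SL).
have Lum : L2 (u_ k \- u) by exact: (si_subc SL).
have Cvm : C (v_ m \- v_ k) by exact: (si_subc S).
have T1 : `|L2inner mu (v_ m \- v) w| <= e / 3.
  by apply: (si_bound SL Lvm Lw e3 (K0 _ Lw)) => //; rewrite ltW// HN2// leq_maxr.
have T2 : `|L2inner mu (u_ k \- u) a| <= e / 3.
  by apply: (si_bound SL Lum La e3 (K0 _ La)) => //; rewrite ltW// HN3.
have T3 : `|B (v_ m \- v_ k) (u_ k)| <= e / 3.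
  by apply: (si_bound S Cvm (Cu k) e3 M0); [rewrite ltW// HN1// leq_maxl|exact: uM].
have -> : L2inner mu w v - B (u_ k) (v_ k) =
    B (v_ m \- v_ k) (u_ k) - L2inner mu (v_ m \- v) w - L2inner mu (u_ k \- u) a.
  rewrite (si_subl S (Cv m) (Cv k) (Cu k)) (si_subl SL (LCv m) Lv Lw).
  rewrite (si_subl SL (LCu k) Lu La) uva -(va _ (Cu k)).
  rewrite (si_sym S (Cv m) (Cu k)) (si_sym S (Cv k) (Cu k)).
  by rewrite (si_sym SL (LCv m) Lw) (si_sym SL Lv Lw); ring.
move: T1 T2 T3; move: (B _ _) (L2inner mu _ w) (L2inner mu _ a) => x1 x2 x3 T1 T2 T3.
by rewrite (le_trans (ler_normB _ _))//; have := ler_normB x1 x2; lra.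
Qed.

(** This is closability: the case [u = w = 0] of [form_weak_limit]. *)
Lemma form_null_limit (z_ v_ : nat -> R -> R) (v : R -> R) : L2 v ->
  form_approx mu C q z_ (cst 0) -> form_approx mu C q v_ v ->
  B (z_ k) (v_ k) @[k --> \oo] --> 0.
Proof.
move=> Lv za va.
have L0 : L2 (cst 0).
  have := si_scalec SL 0 Lv; rewrite (_ : (fun x => _) = cst 0)//.
  by apply/funext => x; rewrite mul0r.
have i0 a : L2inner mu (cst 0) a = 0.
  rewrite /L2inner; under eq_Rintegral do rewrite mul0r.
  by rewrite /Rintegral integral0.
rewrite -(i0 v); apply: (form_weak_limit L0 Lv L0 za va) => phi /reprC[a La pa].
by exists a; split; rewrite ?i0.
Qed.

Lemma form_approx_add (u_ v_ : nat -> R -> R) (u v : R -> R) : L2 u -> L2 v ->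
  form_approx mu C q u_ u -> form_approx mu C q v_ v ->
  form_approx mu C q (fun k => u_ k \+ v_ k) (u \+ v).
Proof.
move=> Lu Lv /[dup] ua /(form_approx_near Lu)[Cu uu uC _].
move=> /[dup] va /(form_approx_near Lv)[Cv vv vC _].
have e4 e : 0 < e -> 0 < e / 4 :> R by move=> e0; rewrite divr_gt0.
split.
- by move=> k; exact: (si_addc S).
- have Ld k : L2 ((u_ k \+ v_ k) \- (u \+ v)).
    by apply: (si_subc SL); apply: (si_addc SL) => //; exact: CL2.
  apply/(Lnorm2_cvg0 Ld)/cvgrPdist_le => e e0.
  have [N1 H1] := uu _ (e4 _ e0); have [N2 H2] := vv _ (e4 _ e0).
  exists (maxn N1 N2) => // k /=; rewrite geq_max => /andP[k1 k2].
  have -> : (u_ k \+ v_ k) \- (u \+ v) = (u_ k \- u) \+ (v_ k \- v).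
    by apply/funext => x /=; ring.
  have Lu' : L2 (u_ k \- u) by apply: (si_subc SL) => //; exact: CL2.
  have Lv' : L2 (v_ k \- v) by apply: (si_subc SL) => //; exact: CL2.
  rewrite sub0r normrN ger0_norm; last by apply: (si_ge0 SL); exact: (si_addc SL).
  apply: (le_trans (si_add_le SL Lu' Lv')).
  by have := H1 k k1; have := H2 k k2; lra.
- move=> e e0; have [N1 H1] := uC _ (e4 _ e0); have [N2 H2] := vC _ (e4 _ e0).
  exists (maxn N1 N2) => k m; rewrite !geq_max => /andP[k1 k2] /andP[m1 m2].
  have -> : (u_ k \+ v_ k) \- (u_ m \+ v_ m) = (u_ k \- u_ m) \+ (v_ k \- v_ m).
    by apply/funext => x /=; ring.
  have Cu' := si_subc S (Cu k) (Cu m); have Cv' := si_subc S (Cv k) (Cv m).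
  rewrite qB; last exact: (si_addc S).
  apply: (le_lt_trans (si_add_le S Cu' Cv')).
  by have := H1 k m k1 m1; have := H2 k m k2 m2; lra.
Qed.

Lemma form_approx_opp (u_ : nat -> R -> R) (u : R -> R) : L2 u ->
  form_approx mu C q u_ u ->
  form_approx mu C q (fun k x => -1 * u_ k x) (fun x => -1 * u x).
Proof.
move=> Lu /[dup] ua /(form_approx_near Lu)[Cu uu uC _].
have eq (a b : R -> R) : (fun x => -1 * a x) \- (fun x => -1 * b x) = (fun x => -1 * (a \- b) x).
  by apply/funext => x /=; ring.
split.
- by move=> k; exact: (si_scalec S).
- have Lu' k : L2 (u_ k \- u) by apply: (si_subc SL) => //; exact: CL2.
  have Ld k : L2 ((fun x => -1 * u_ k x) \- (fun x => -1 * u x)).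
    by rewrite eq; apply: (si_scalec SL).
  apply/(Lnorm2_cvg0 Ld); under eq_fun do rewrite eq (si_opp SL)//.
  by apply/(Lnorm2_cvg0 Lu'); case: ua.
- move=> e e0; have [N H] := uC _ e0; exists N => k m Nk Nm.
  have Cu' := si_subc S (Cu k) (Cu m).
  by rewrite eq qB ?(si_opp S)//; [exact: H|exact: (si_scalec S)].
Qed.

Lemma form_approx_sub (u_ v_ : nat -> R -> R) (u v : R -> R) : L2 u -> L2 v ->
  form_approx mu C q u_ u -> form_approx mu C q v_ v ->
  form_approx mu C q (fun k => u_ k \- v_ k) (u \- v).
Proof.
move=> Lu Lv ua va; under eq_fun do rewrite sub_funE; rewrite sub_funE.
by apply: form_approx_add => //; [exact: (si_scalec SL)|exact: form_approx_opp].
Qed.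

Lemma form_approx_cvg (u_ : nat -> R -> R) (u : R -> R) : L2 u ->
  form_approx mu C q u_ u -> cvg (q (u_ k) @[k --> \oo]).
Proof.
move=> Lu /(form_approx_near Lu)[Cu _ uC [M M0 [N0 uM]]].
apply/cauchy_cvgP/cauchy_exP => e e0.
have e2 : 0 < e / 4 by rewrite divr_gt0.
have [N HN] := uC _ (divr_gt0 (exprn_gt0 2 e2) M0).
pose m := maxn N0 N; exists (q (u_ m)); exists m => // k /=.
rewrite geq_max => /andP[k0 kN].
have mN : (N <= m)%N by rewrite leq_maxr.
have m0 : (N0 <= m)%N by rewrite leq_maxl.
have Cmk := si_subc S (Cu m) (Cu k).
have T1 : `|B (u_ m \- u_ k) (u_ m)| <= e / 4.
  by apply: (si_bound S Cmk (Cu m) e2 M0); [rewrite ltW// HN|exact: uM].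
have T2 : `|B (u_ m \- u_ k) (u_ k)| <= e / 4.
  by apply: (si_bound S Cmk (Cu k) e2 M0); [rewrite ltW// HN|exact: uM].
rewrite /ball /= !qB//.
have -> : B (u_ m) (u_ m) - B (u_ k) (u_ k) =
    B (u_ m \- u_ k) (u_ m) + B (u_ m \- u_ k) (u_ k).
  rewrite (si_subl S (Cu m) (Cu k) (Cu m)) (si_subl S (Cu m) (Cu k) (Cu k)).
  by rewrite (si_sym S (Cu k) (Cu m)); ring.
by rewrite (le_lt_trans (ler_normD _ _))//; lra.
Qed.

Lemma form_closure_cvg (u_ : nat -> R -> R) (u : R -> R) : L2 u ->
  form_approx mu C q u_ u -> q (u_ k) @[k --> \oo] --> form_closure mu C q u.
Proof.
move=> Lu ua; have cu := form_approx_cvg Lu ua.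
rewrite /form_closure; case: xgetP => [l _ [v_ va vl]|/(_ (lim (q (u_ k) @[k --> \oo])))].
  (* [xget] may have chosen another sequence [v_]; the difference [q (u_ k) - q (v_ k)] is [B (u_ k
     \- v_ k) (u_ k) + B (u_ k \- v_ k) (v_ k)], and [u_ k \- v_ k] approximates 0. *)
  have za := form_approx_sub Lu Lu ua va.
  have zE : u \- u = cst 0 by apply/funext => x /=; rewrite subrr.
  rewrite zE in za.
  have : q (v_ k) + B (u_ k \- v_ k) (u_ k) + B (u_ k \- v_ k) (v_ k) @[k --> \oo] -->
      l + 0 + 0.
    by apply: cvgD; [apply: cvgD => //; exact: form_null_limit ua|exact: form_null_limit va].
  rewrite !addr0; apply: eq_cvgn => k /=.
  have [Cu _ _] := ua; have [Cv _ _] := va.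
  rewrite !qB// !(si_subl S)// (si_sym S (Cv k) (Cu k)); ring.
by move=> H; exfalso; apply: H; exists u_.
Qed.

Lemma form_polar_cvg (u_ v_ : nat -> R -> R) (u v : R -> R) : L2 u -> L2 v ->
  form_approx mu C q u_ u -> form_approx mu C q v_ v ->
  B (u_ k) (v_ k) @[k --> \oo] --> form_polar mu C q u v.
Proof.
move=> Lu Lv ua va.
have c1 := form_closure_cvg (si_addc SL Lu Lv) (form_approx_add Lu Lv ua va).
have c2 := form_closure_cvg (si_subc SL Lu Lv) (form_approx_sub Lu Lv ua va).
have : (q (u_ k \+ v_ k) - q (u_ k \- v_ k)) / 4 @[k --> \oo] -->
    form_polar mu C q u v by apply: cvgMr_tmp; exact: cvgB.
apply: eq_cvgn => k /=.
have [Cu _ _] := ua; have [Cv _ _] := va.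
have Ca := si_addc S (Cu k) (Cv k); have Cs := si_subc S (Cu k) (Cv k).
rewrite !qB// (si_add S (Cu k) (Cv k) Ca) (si_subl S (Cu k) (Cv k) Cs).
rewrite !(si_addr S (Cu k) (Cv k))// !(si_subr S (Cu k) (Cv k))//.
by rewrite (si_sym S (Cv k) (Cu k)); field.
Qed.

(** Reduces the operator to its weak form: it is tried on test functions only and acts on them,
    through their representatives, rather than on [u]; [form_weak_limit] extends the identity to the
    whole form domain. *)
Lemma form_op_intro (u w : R -> R) : form_dom mu C q u -> L2 w ->
  (forall phi, C phi -> exists a,
    [/\ L2 a, represents phi a & L2inner mu u a = L2inner mu w phi]) ->
  form_op mu C q u w.
Proof.
move=> [Lu [u_ ua]] Lw uw; split=> // [|v [Lv [v_ va]]]; first by split=> //; exists u_.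
apply: (@cvg_unique _ (@Rhausdorff R) _ _ _ _ (form_polar_cvg Lu Lv ua va)).
exact: form_weak_limit Lu Lv Lw ua va uw.
Qed.

Lemma form_polar_sym (u v : R -> R) : form_dom mu C q u -> form_dom mu C q v ->
  form_polar mu C q u v = form_polar mu C q v u.
Proof.
move=> [Lu [u_ ua]] [Lv [v_ va]].
apply: (@cvg_unique _ (@Rhausdorff R) _ _ _ _ (form_polar_cvg Lu Lv ua va)).
have := form_polar_cvg Lv Lu va ua.
have [Cu _ _] := ua; have [Cv _ _] := va.
by under eq_fun => k do rewrite (si_sym S (Cv k) (Cu k)).
Qed.

Lemma form_polar_ge0 (u : R -> R) : form_dom mu C q u -> 0 <= form_polar mu C q u u.
Proof.
move=> [Lu [u_ ua]]; have c := form_polar_cvg Lu Lu ua ua.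
have [Cu _ _] := ua.
have <- := cvg_lim (@Rhausdorff R) c.
apply: limr_ge; first by apply/cvg_ex; eexists; exact: c.
by apply: nearW => k; exact: (si_ge0 S).
Qed.

(** For any solution [v] that [xget] may choose, [<v, g> = form_polar u v + <u, v> = <u, g>] by
    symmetry, so the choice does not affect the inner product. Taking [v = u] gives the sign. *)
Lemma inv_id_plus_inner (u g : R -> R) : L2 g -> form_op mu C q u (g \- u) ->
  L2inner mu (inv_id_plus (form_op mu C q) g) g = L2inner mu u g /\
  0 <= L2inner mu u g.
Proof.
move=> Lg ug; have [du Lgu pu] := ug; have Lu := du.1.
have gE (v : R -> R) : g = (g \- v) \+ v by apply/funext => x /=; rewrite subrK.
split; last first.
  rewrite (gE u) (si_addr SL Lgu Lu Lu) (si_sym SL Lu Lgu) -pu//.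
  by rewrite addr_ge0// ?(si_ge0 SL)//; exact: form_polar_ge0.
rewrite /inv_id_plus; case: xgetP => [v _ vg|/(_ u)//].
have [dv Lgv pv] := vg; have Lv := dv.1.
rewrite [in LHS](gE u) (si_addr SL Lgu Lu Lv) (si_sym SL Lv Lgu) -pu//.
rewrite (form_polar_sym du dv) pv// (si_sym SL Lv Lu) -(si_sym SL Lu Lgv).
by rewrite -(si_addr SL Lgv Lv Lu) -gE.
Qed.

End FormTheory.

(** * The form of [D E^-1 Dstar] on test functions, and its energy norm *)

Section ConcreteForm.
Context {R : realType} (V E : R -> R) (mu : probability (measurableTypeR R) R).
Hypothesis kV : class_C 2 V.
Hypothesis kE : class_C 1 E.
Hypothesis E0 : forall x, 0 < E x.
Hypothesis muE : forall A : set (measurableTypeR R), measurable A ->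
  mu A = (\int[lebesgue_measure]_(x in A) (expR (- V x))%:E)%E.

Local Notation L2 := [set f | f \in Lfun mu 2%:E].
Local Notation C := (@test_function R).
Local Notation q := (fun phi => \int[mu]_x ((E x)^-1 * (Dstar V phi x) ^+ 2)).
Local Notation V1 := (derive1 V).

Let cV : continuous V := class_C_continuous kV.

Let dV x : isd x V (V1 x).
Proof. exact: class_C_is_derive kV. Qed.

Let kV1 : class_C 1 V1 := class_C_derive1 kV.

Let En0 x : E x != 0. Proof. by rewrite gt_eqF. Qed.

Let kEV : class_C 1 (fun x => (E x)^-1) := class_CV En0 kE.

Lemma supported_L2 (h : R -> R) (K : R) : continuous h -> supported K h -> L2 h.
Proof.
move=> ch hK; apply: L2P; first exact: continuous_measurableT.
apply: (@supported_integrable _ _ _ K) => //.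
- by apply/class_C0/class_CX/class_C0.
- by move=> x /hK ->; rewrite expr0n.
Qed.

Lemma test_supported phi : C phi -> (forall k, class_C k phi) /\ exists2 K, 0 < K & supported K phi.
Proof. by move=> [kphi /compact_supported ?]. Qed.

Lemma Dstar_class_C k phi : class_C k V1 -> class_C k.+1 phi -> class_C k (Dstar V phi).
Proof.
move=> kV' kphi; apply: class_CD; first exact: class_CN (class_C_derive1 kphi).
by apply: class_CM => //; exact: class_CW kphi.
Qed.

Lemma Dstar_test phi : C phi -> class_C 1 (Dstar V phi).
Proof. by move=> [kphi _]; exact: Dstar_class_C kV1 (kphi 2%N). Qed.

Lemma Dstar_supported K phi : class_C 1 phi -> supported K phi -> supported K (Dstar V phi).
Proof.
move=> kphi pK x Kx; rewrite /Dstar pK// mulr0 addr0.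
have dphi z : isd z phi (derive1 phi z) by exact: class_C_is_derive kphi.
by rewrite (supported_isd dphi pK)// oppr0.
Qed.

Definition bform (u v : R -> R) : R := \int[mu]_x ((E x)^-1 * Dstar V u x * Dstar V v x).

Lemma bform_integrable u v : C u -> C v ->
  mu.-integrable setT (EFin \o (fun x => (E x)^-1 * Dstar V u x * Dstar V v x)).
Proof.
move=> Cu Cv; have [ku [K K0 uK]] := test_supported Cu.
apply: (@supported_integrable _ _ _ K); first exact: measurableT.
- exact: class_C_continuous (class_CM (class_CM kEV (Dstar_test Cu)) (Dstar_test Cv)).
- apply: (@supportedMl _ K (fun x => (E x)^-1 * Dstar V u x)).
  exact: supportedMr (Dstar_supported (ku 1%N) uK).
Qed.

Lemma DstarD u v : C u -> C v -> Dstar V (u \+ v) = Dstar V u \+ Dstar V v.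
Proof.
move=> [ku _] [kv _]; apply/funext => x; rewrite /Dstar /=.
rewrite (isd_val (isdD (class_C_is_derive x (ku 1%N)) (class_C_is_derive x (kv 1%N)))).
by ring.
Qed.

Lemma DstarZ a u : C u -> Dstar V (fun x => a * u x) = fun x => a * Dstar V u x.
Proof.
move=> [ku _]; apply/funext => x; rewrite /Dstar /=.
rewrite (isd_val (isdM (isd_cst a x) (class_C_is_derive x (ku 1%N)))).
by ring.
Qed.

Lemma bform_semi_inner : semi_inner C bform.
Proof.
have addC u v : C u -> C v -> C (u \+ v).
  move=> /test_supported[ku [K K0 uK]] /test_supported[kv [L L0 vL]]; split.
    by move=> k; exact: class_CD.
  apply: (@supported_compact _ (Num.max K L)) => x.
  by rewrite gt_max => /andP[/uK ux /vL vx]; rewrite /= ux vx addr0.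
have scaleC a u : C u -> C (fun x => a * u x).
  move=> /test_supported[ku [K K0 uK]]; split.
    by move=> k; apply: class_CM => //; exact: class_C_cst.
  by apply: (@supported_compact _ K); exact: supportedMr.
split=> //.
- move=> u v w Cu Cv Cw; rewrite /bform DstarD// -RintegralD//; try exact: bform_integrable.
  by apply: eq_Rintegral => x _ /=; ring.
- move=> a u w Cu Cw; rewrite /bform DstarZ// -RintegralZl//; last exact: bform_integrable.
  by apply: eq_Rintegral => x _ /=; ring.
- by move=> u v _ _; apply: eq_Rintegral => x _; ring.
- move=> u _; apply: Rintegral_ge0 => x _.
  by rewrite -mulrA mulr_ge0 ?invr_ge0 ?(ltW (E0 _))// -expr2 sqr_ge0.
Qed.

Lemma bform_diag u : C u -> q u = bform u u.
Proof. by move=> _; apply: eq_Rintegral => x _; rewrite expr2 mulrA. Qed.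

Lemma test_L2 : C `<=` L2.
Proof.
move=> u /test_supported[ku [K _ uK]]; apply: supported_L2 uK.
exact: class_C_continuous (ku 0%N).
Qed.

Lemma mu_int_parts (u a u' a' : R -> R) (K : R) : (forall x, isd x u (u' x)) ->
  (forall x, isd x a (a' x)) -> continuous u' -> continuous a' ->
  supported K u \/ supported K a ->
  \int[mu]_x (u x * a' x) = \int[mu]_x ((V1 x * u x - u' x) * a x).
Proof.
move=> du da cu' ca' ua.
have kb : class_C 1 u by apply: class_C_isd du _; exact/class_C0.
have ka : class_C 1 a by apply: class_C_isd da _; exact/class_C0.
have kb0 := class_CW (leq0n 1) kb; have ka0 := class_CW (leq0n 1) ka.
have kV10 := class_CW (leq0n 1) kV1.
have ku'0 : class_C 0 u' by exact/class_C0.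
have ka'0 : class_C 0 a' by exact/class_C0.
have kX : class_C 0 (fun x => expR (- V x)).
  by apply/class_C_expR/class_CN; exact/class_C0.
have k1 : class_C 0 (fun x => u x * a' x) by exact: class_CM.
have k2 : class_C 0 (fun x => (V1 x * u x - u' x) * a x).
  by apply: class_CM => //; apply: class_CB => //; exact: class_CM.
have [s1 s2] : supported K (fun x => u x * a' x) /\
    supported K (fun x => (V1 x * u x - u' x) * a x).
  case: ua => [uK|aK]; last first.
    by split; apply: supportedMr => //; exact: supported_isd da aK.
  split; apply: supportedMl => // x Kx.
  by rewrite uK// (supported_isd du uK)// mulr0 subr0.
apply/eqP; rewrite -subr_eq0 -RintegralB//; last 2 first.
- by apply: (@supported_integrable _ _ _ K) => //; exact/class_C0.
- by apply: (@supported_integrable _ _ _ K) => //; exact/class_C0.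
apply/eqP.
pose P x := u x * a x * expR (- V x).
pose p x := (u x * a' x - (V1 x * u x - u' x) * a x) * expR (- V x).
have dP x : isd x P (p x).
  by rewrite /P /p; der (first [exact: du | exact: da | exact: dV]); ring.
have cp : continuous p by apply/class_C0/class_CM => //; exact: class_CB.
have PK : supported K P.
  by case: ua => [uK|aK]; apply: supportedMl; [exact: supportedMl|exact: supportedMr].
rewrite -[RHS](mu_int_deriv0 cV muE dP cp PK); apply: eq_Rintegral => x _.
by rewrite /p -mulrA -expRD addNr expR0 mulr1.
Qed.

Lemma Dstar_isd u u' : (forall x, isd x u (u' x)) ->
  Dstar V u = fun x => V1 x * u x - u' x.
Proof. by move=> du; apply/funext => x; rewrite /Dstar (isd_val (du x)) addrC. Qed.

Lemma bform_repr v (w := derive1 (fun x => (E x)^-1 * Dstar V v x)) : C v ->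
  [/\ L2 w, represents mu C bform v w &
    forall u u', (forall x, isd x u (u' x)) -> continuous u' ->
      L2inner mu u w = \int[mu]_x ((V1 x * u x - u' x) * ((E x)^-1 * Dstar V v x))].
Proof.
move=> Cv; have [kv [K _ vK]] := test_supported Cv.
have ka : class_C 1 (fun x => (E x)^-1 * Dstar V v x).
  exact: class_CM kEV (Dstar_test Cv).
have da x : isd x (fun x => (E x)^-1 * Dstar V v x) (w x) by exact: class_C_is_derive ka.
have aK : supported K (fun x => (E x)^-1 * Dstar V v x).
  exact: supportedMr (Dstar_supported (kv 1%N) vK).
have cw : continuous w by exact: class_C_continuous (class_C_derive1 ka).
have H u u' : (forall x, isd x u (u' x)) -> continuous u' ->
    L2inner mu u w = \int[mu]_x ((V1 x * u x - u' x) * ((E x)^-1 * Dstar V v x)).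
  by move=> du cu'; apply: (mu_int_parts du da cu' cw); right; exact: aK.
split=> //; first exact: supported_L2 (supported_isd da aK).
move=> u [ku _]; have du x : isd x u (derive1 u x) by exact: class_C_is_derive (ku 1%N).
rewrite (H u (derive1 u)) //; last exact: class_C_continuous (class_C_derive1 (ku 1%N)).
by apply: eq_Rintegral => x _; rewrite (Dstar_isd du); ring.
Qed.

Lemma bform_reprC v : C v -> exists2 w, L2 w & represents mu C bform v w.
Proof. by move=> /bform_repr[Lw rw _]; eexists; [exact: Lw|exact: rw]. Qed.

(** The integral is the squared form norm when [d] is [Dstar V u]; [d] is a separate argument so
    that energies of differences are computed pointwise. *)
Definition energy (u d : R -> R) (x : R) : R := u x ^+ 2 + (E x)^-1 * d x ^+ 2.

Definition finite_energy (u d : R -> R) : Prop :=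
  [/\ continuous u, continuous d & mu.-integrable setT (EFin \o energy u d)].

Lemma energy_ge0 u d x : 0 <= energy u d x.
Proof. by rewrite addr_ge0 ?sqr_ge0// mulr_ge0 ?sqr_ge0 ?invr_ge0 ?ltW. Qed.

Lemma energy_continuous u d : continuous u -> continuous d -> continuous (energy u d).
Proof.
move=> /class_C0 cu /class_C0 cd; apply/class_C0.
exact: class_CD (class_CX 2 cu) (class_CM (class_CW (leq0n 1) kEV) (class_CX 2 cd)).
Qed.

Lemma le_continuous_integrable (f g : R -> R) : continuous f ->
  mu.-integrable setT (EFin \o g) -> (forall x, 0 <= f x <= g x) ->
  mu.-integrable setT (EFin \o f).
Proof.
move=> cf ig fg; apply: (le_integrable _ _ _ ig) => //.
  by apply/measurable_EFinP; exact: continuous_measurableT.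
move=> x _ /=; have /andP[f0 fgx] := fg x.
by rewrite lee_fin !ger0_norm// (le_trans f0).
Qed.

Lemma energy_sub_le u d v e x :
  energy (u \- v) (d \- e) x <= 2 * energy u d x + 2 * energy v e x.
Proof.
rewrite /energy /=; have := E0 x; rewrite -invr_gt0; set w := (E x)^-1 => w0.
have A : (u x - v x) ^+ 2 <= 2 * u x ^+ 2 + 2 * v x ^+ 2.
  by rewrite -subr_ge0 (_ : _ - _ = (u x + v x) ^+ 2) ?sqr_ge0//; ring.
have B : (d x - e x) ^+ 2 <= 2 * d x ^+ 2 + 2 * e x ^+ 2.
  by rewrite -subr_ge0 (_ : _ - _ = (d x + e x) ^+ 2) ?sqr_ge0//; ring.
have := ler_wpM2l (ltW w0) B; move: A; set a := (u x - v x) ^+ 2.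
set b := w * (d x - e x) ^+ 2; lra.
Qed.

Lemma energy_bound_integrable u d v e : finite_energy u d -> finite_energy v e ->
  mu.-integrable setT (EFin \o (fun x => 2 * energy u d x + 2 * energy v e x)).
Proof.
move=> [_ _ iu] [_ _ iv].
have := integrableD measurableT (integrableZl measurableT 2 iu)
  (integrableZl measurableT 2 iv).
by [].
Qed.

Lemma finite_energy_sub u d v e : finite_energy u d -> finite_energy v e ->
  finite_energy (u \- v) (d \- e).
Proof.
move=> fu fv; have [cu cd _] := fu; have [cv ce _] := fv.
have c1 : continuous (u \- v) by apply/class_C0/class_CB; exact/class_C0.
have c2 : continuous (d \- e) by apply/class_C0/class_CB; exact/class_C0.
split=> //; apply: le_continuous_integrable (energy_bound_integrable fu fv) _.
  exact: energy_continuous.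
by move=> x; rewrite energy_ge0 energy_sub_le.
Qed.

Lemma Rintegral_energy_sub_le u d v e : finite_energy u d -> finite_energy v e ->
  \int[mu]_x energy (u \- v) (d \- e) x <=
  2 * \int[mu]_x energy u d x + 2 * \int[mu]_x energy v e x.
Proof.
move=> fu fv; have [_ _ iu] := fu; have [_ _ iv] := fv.
rewrite -!RintegralZl// -RintegralD//; last 2 first.
- exact: (integrableZl measurableT 2 iu).
- exact: (integrableZl measurableT 2 iv).
apply: le_Rintegral => //.
- by have [] := finite_energy_sub fu fv.
- exact: energy_bound_integrable.
- by move=> x _; exact: energy_sub_le.
Qed.

Lemma finite_energy_L2 u d : finite_energy u d -> L2 u.
Proof.
move=> [cu cd iu]; apply: L2P; first exact: continuous_measurableT.
apply: le_continuous_integrable iu _.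
  by apply/class_C0/class_CX/class_C0.
move=> x; rewrite sqr_ge0/= /energy lerDl mulr_ge0 ?sqr_ge0// invr_ge0 ltW//.
Qed.

Lemma finite_energy_inner u d : finite_energy u d ->
  L2inner mu u u <= \int[mu]_x energy u d x.
Proof.
move=> fu; have [_ _ iu] := fu; have Lu := finite_energy_L2 fu.
apply: le_Rintegral => //; first exact: L2_mul_integrable.
by move=> x _; rewrite -expr2 /energy lerDl mulr_ge0 ?sqr_ge0// invr_ge0 ltW.
Qed.

Lemma supported_finite_energy u d K : continuous u -> continuous d ->
  supported K u -> supported K d -> finite_energy u d.
Proof.
move=> cu cd uK dK; split=> //; apply: (@supported_integrable _ _ _ K) => //.
  exact: energy_continuous.
by move=> x Kx; rewrite /energy uK// dK// !expr0n/= mulr0 addr0.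
Qed.

Lemma test_finite_energy phi : C phi -> finite_energy phi (Dstar V phi).
Proof.
move=> Cphi; have [kphi [K _ pK]] := test_supported Cphi.
apply: supported_finite_energy pK (Dstar_supported (kphi 1%N) pK).
  exact: class_C_continuous (kphi 0%N).
exact: class_C_continuous (Dstar_test Cphi).
Qed.

(** The integrated energy controls both the [L^2] distance and the form, so approximation in energy
    gives at once the two limits of [form_approx]. *)
Lemma form_domI u d : finite_energy u d ->
  (forall e, 0 < e -> exists2 phi, C phi &
    \int[mu]_x energy (phi \- u) (Dstar V phi \- d) x <= e) ->
  form_dom mu C q u.
Proof.
move=> fu H; split; first exact: finite_energy_L2 fu.
have /choice[u_ Hu] : forall k : nat, exists phi, C phi /\
    \int[mu]_x energy (phi \- u) (Dstar V phi \- d) x <= k.+1%:R^-1.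
  move=> k; have [phi Cphi Hphi] := H k.+1%:R^-1 ltac:(by rewrite invr_gt0).
  by exists phi.
exists u_; have Cu k : C (u_ k) by have [] := Hu k.
have fuk k := finite_energy_sub (test_finite_energy (Cu k)) fu.
split=> //.
- apply/Lnorm2_cvg0 => [k|]; first exact: finite_energy_L2 (fuk k).
  apply/cvgrPdist_lt => e e0; have [N _ HN] := near_infty_natSinv_lt (PosNum e0).
  exists N => // k /HN; apply: le_lt_trans; rewrite sub0r normrN.
  rewrite ger0_norm; last exact: si_ge0 (L2_semi_inner mu) _ (finite_energy_L2 (fuk k)).
  by rewrite (le_trans (finite_energy_inner (fuk k)))//; have [] := Hu k.
(* The factors 2 of [energy_sub_le] turn two errors [e / 8] into [e / 2 < e]. *)
- move=> e e0; have e4 : 0 < e / 8 by rewrite divr_gt0.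
  have [N _ HN] := near_infty_natSinv_lt (PosNum e4).
  have small k : (N <= k)%N -> \int[mu]_x energy (u_ k \- u) (Dstar V (u_ k) \- d) x <= e / 8.
    move=> /HN /ltW; apply: le_trans.
    by have [] := Hu k.
  exists N => k m /small Ik /small Im.
  have Ckm : C (u_ k \- u_ m) := si_subc bform_semi_inner (Cu k) (Cu m).
  have Du : Dstar V (u_ k \- u_ m) =
      (Dstar V (u_ k) \- d) \- (Dstar V (u_ m) \- d).
    have -> : u_ k \- u_ m = u_ k \+ (fun x => -1 * u_ m x) by rewrite sub_funE.
    rewrite DstarD ?DstarZ//; first by apply/funext => x /=; ring.
    exact: (si_scalec bform_semi_inner).
  have Uu : u_ k \- u_ m = (u_ k \- u) \- (u_ m \- u) by apply/funext => x /=; ring.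
  apply: (@le_lt_trans _ _ (\int[mu]_x energy (u_ k \- u_ m) (Dstar V (u_ k \- u_ m)) x)).
    apply: le_Rintegral => //.
    + have := bform_integrable Ckm Ckm; apply: eq_integrable => // x _ /=.
      by rewrite expr2 mulrA.
    + by have [] := test_finite_energy Ckm.
    + by move=> x _; rewrite /energy lerDr sqr_ge0.
  rewrite Du Uu (le_lt_trans (Rintegral_energy_sub_le (fuk k) (fuk m)))//; lra.
Qed.

Lemma mollify_energy (v v' : R -> R) (L e : R) : 0 < L -> (forall x, isd x v (v' x)) ->
  continuous v' -> supported L v -> 0 < e ->
  exists2 phi, C phi &
    \int[mu]_x energy (phi \- v) (Dstar V phi \- (fun x => V1 x * v x - v' x)) x <= e.
Proof.
move=> L0 dv cv' vL e0; have v'L := supported_isd dv vL.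
(* If [phi - v] and its derivative are at most [d] in absolute value, the energy density of the
   difference is at most [d ^+ 2 * m x]. As [mu] has mass 1, a bound of [m] on [[-(L+1), L+1]]
   suffices. *)
pose m x := 1 + 2 * (E x)^-1 * (V1 x ^+ 2 + 1).
have cm : continuous m.
  apply/class_C0/class_CD; first exact: class_C_cst.
  apply: class_CM; first by apply: class_CM; [exact: class_C_cst|exact: class_CW kEV].
  by apply: class_CD; [apply: class_CX; exact: class_CW kV1|exact: class_C_cst].
have [M M0 mM] := continuous_bounded_segment (L + 1) cm.
pose d := Num.min 1 (e / M).
have d0 : 0 < d by rewrite lt_min ltr01 divr_gt0.
have dM : d ^+ 2 * M <= e.
  rewrite -ler_pdivlMr//; apply: (@le_trans _ _ d); last by rewrite ge_min lexx orbT.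
  by rewrite expr2 ler_piMl ?(ltW d0)// ge_min lexx.
have [phi [kphi pL pv pv']] := mollify L0 dv cv' vL d0.
have Cphi : C phi by split=> //; exact: supported_compact pL.
exists phi => //; apply: le_trans dM.
have dphi x : isd x phi (derive1 phi x) by exact: class_C_is_derive (kphi 1%N).
have -> : d ^+ 2 * M = \int[mu]_x (d ^+ 2 * M).
  rewrite Rintegral_cst// -[LHS]mulr1; congr (_ * _).
  exact: (esym (congr1 fine (probability_setT mu))).
have cv := isd_continuous dv.
have fv : finite_energy v (fun x => V1 x * v x - v' x).
  apply: (@supported_finite_energy _ _ L) => //.
    apply/class_C0/class_CB; last exact/class_C0.
    by apply: class_CM; [exact: class_CW kV1|exact/class_C0].
  by move=> x Lx; rewrite vL// v'L// mulr0 subr0.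
apply: le_Rintegral => //.
- by have [] := finite_energy_sub (test_finite_energy Cphi) fv.
- by apply: finite_measure_integrable_cst.
- move=> x _; rewrite /energy (Dstar_isd dphi) /=.
  have [xL|xL] := leP `|x| (L + 1); last first.
    have L1 : L < `|x| by apply: lt_trans xL; rewrite ltrDl.
    rewrite pL// (supported_isd dphi pL)// vL// v'L// !subr0 mulr0 subr0 !expr0n/=.
    by rewrite mulr0 addr0 mulr_ge0 ?sqr_ge0 ?ltW.
  have := mM x xL; rewrite ger0_norm => [mx|]; last first.
    by rewrite addr_ge0// !mulr_ge0 ?invr_ge0 ?(ltW (E0 x))// addr_ge0 ?sqr_ge0.
  apply: le_trans (ler_wpM2l (sqr_ge0 d) mx).
  rewrite /m mulrDr mulr1 lerD//.
    by rewrite -(real_normK (num_real _)) ler_pXn2r ?nnegrE ?(ltW d0).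
  have -> : V1 x * phi x - derive1 phi x - (V1 x * v x - v' x) =
    V1 x * (phi x - v x) - (derive1 phi x - v' x) by ring.
  have A : (phi x - v x) ^+ 2 <= d ^+ 2.
    by rewrite -(real_normK (num_real _)) ler_pXn2r ?nnegrE ?(ltW d0).
  have B : (derive1 phi x - v' x) ^+ 2 <= d ^+ 2.
    by rewrite -(real_normK (num_real _)) ler_pXn2r ?nnegrE ?(ltW d0).
  move: A B; move: (phi x - v x) (derive1 phi x - v' x) => a b A B.
  have -> : d ^+ 2 * (2 * (E x)^-1 * (V1 x ^+ 2 + 1)) =
    (E x)^-1 * (2 * (V1 x ^+ 2 + 1) * d ^+ 2) by ring.
  rewrite ler_wpM2l ?invr_ge0 ?(ltW (E0 x))//.
  apply: (@le_trans _ _ (2 * (V1 x ^+ 2 * a ^+ 2) + 2 * b ^+ 2)).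
    by rewrite -subr_ge0 (_ : _ - _ = (V1 x * a + b) ^+ 2) ?sqr_ge0//; ring.
  have := ler_wpM2l (sqr_ge0 (V1 x)) A; lra.
Qed.

End ConcreteForm.

(** * Solutions with good tails lie in the form domain *)

Section Resolvent.
Context {R : realType} (V E F y th : R -> R) (K : R).
Context (mu : probability (measurableTypeR R) R).
Hypothesis kV : class_C 2 V.
Hypothesis kE : class_C 1 E.
Hypothesis E0 : forall x, 0 < E x.
Hypothesis muE : forall A : set (measurableTypeR R), measurable A ->
  mu A = (\int[lebesgue_measure]_(x in A) (expR (- V x))%:E)%E.
Hypothesis kF : class_C 1 F.
Hypothesis FK : supported K F.
Hypothesis K0 : 0 < K.
Hypothesis h : sys V E F y th.
Hypothesis right_tail : forall x : R, K < x -> y x * th x <= 0.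
Hypothesis left_tail : forall x : R, x < - K -> 0 <= y x * th x.
Hypothesis decay : forall e : R, 0 < e -> exists X : R, forall x : R, X < `|x| -> `|th x| < e.

Local Notation V1 := (derive1 V).
Local Notation C := (@test_function R).
Local Notation L2 := [set f | f \in Lfun mu 2%:E].

(** [u] is [y'], and [d] below is [Dstar V u]: the equation reads [Dstar V u = F - E y]. *)
Let u x := expR (V x) * th x.
Let d x := F x - E x * y x.

Let cV : continuous V := class_C_continuous kV.
Let En0 x : E x != 0. Proof. by rewrite gt_eqF. Qed.
Let kEV : class_C 1 (fun x => (E x)^-1) := class_CV En0 kE.
Let kV1 : class_C 1 V1 := class_C_derive1 kV.

Let dV x : isd x V (V1 x).
Proof. exact: class_C_is_derive kV. Qed.

Let du x : isd x u (V1 x * u x - d x).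
Proof.
rewrite /u /d; der (first [exact: dV | exact: h.2]).
by rewrite expRN; field; rewrite expR_eq0.
Qed.

Let cy : continuous y := isd_continuous h.1.
Let cth : continuous th := isd_continuous h.2.
Let cu : continuous u := isd_continuous du.

Let cd : continuous d.
Proof.
apply/class_C0/class_CB; first exact: class_CW kF.
by apply: class_CM; [exact: class_CW kE|exact/class_C0].
Qed.

Lemma integrable_itv_bound (f : R -> R) (B : R) : continuous f ->
  (forall x, 0 <= f x) ->
  (forall k, K < k -> \int[mu]_(x in `[- k, k]) f x <= B) ->
  mu.-integrable setT (EFin \o f).
Proof.
move=> cf f0 fB; apply/integrableP; split.
  by apply/measurable_EFinP; exact: continuous_measurableT.
under eq_integral do rewrite gee0_abs ?lee_fin//.
pose S (i : nat) : set (measurableTypeR R) := `[- i%:R, i%:R]%classic.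
have US : \bigcup_i S i = setT.
  apply/seteqP; split=> // x _; exists (Num.trunc `|x|).+1 => //=.
  by rewrite /S /= in_itv/= -ler_norml ltW// truncnS_gt.
have mf : measurable_fun setT (EFin \o f).
  by apply/measurable_EFinP; exact: continuous_measurableT.
have c : (\int[mu]_(x in S i) (f x)%:E @[i --> \oo] -->
    \int[mu]_(x in \bigcup_i S i) (f x)%:E)%E.
  apply: ge0_nondecreasing_set_cvg_integral.
  - move=> i j ij; apply/subsetPset => x; rewrite /S /= !in_itv/= -!ler_norml => /le_trans; apply.
    by rewrite ler_nat.
  - by move=> i; exact: measurable_itv.
  - by move=> i; exact: measurable_funTS.
  - by move=> i x _; rewrite lee_fin.
rewrite US in c.
apply: (@le_lt_trans _ _ B%:E); last exact: ltry.
have <- := cvg_lim _ c; last exact: ereal_hausdorff.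
apply: lime_le; first by apply/cvg_ex; eexists; exact: c.
have [N _ HN] := nbhs_infty_gtr K.
exists N => // i /HN /= Ki; have := fB _ Ki; rewrite -lee_fin /Rintegral fineK//.
by apply: integrable_fin_num => //; exact: itv_integrable.
Qed.

(** The energy density times [expR (- V)] is the derivative of [y * th] plus a term supported where
    [F] is. On [[-k, k]] the boundary term is nonpositive by the signs of the tails, which bounds
    the energy independently of [k]. *)
Let fe_u : finite_energy E mu u d.
Proof.
split=> //.
pose p x := expR (V x) * th x ^+ 2 + expR (- V x) * (E x * y x ^+ 2 - y x * F x).
pose G x := (E x)^-1 * F x ^+ 2 - y x * F x.
have eE x : energy E u d x = p x * expR (V x) + G x.
  by rewrite /energy /u /d /p /G expRN; field; rewrite expR_eq0 En0.
have cX : class_C 0 (fun x => expR (V x)) by apply/class_C_expR/class_C0.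
have cXN : class_C 0 (fun x => expR (- V x)) by apply/class_C_expR/class_CN/class_C0.
have ky : class_C 0 y by exact/class_C0.
have kth : class_C 0 th by exact/class_C0.
have kF0 := class_CW (leq0n 1) kF; have kE0 := class_CW (leq0n 1) kE.
have kEV0 := class_CW (leq0n 1) kEV.
have cp : continuous p.
  apply/class_C0/class_CD; first exact: class_CM cX (class_CX 2 kth).
  exact: class_CM cXN (class_CB (class_CM kE0 (class_CX 2 ky)) (class_CM ky kF0)).
have cG : continuous G.
  apply/class_C0; exact: class_CB (class_CM kEV0 (class_CX 2 kF0)) (class_CM ky kF0).
have GK : supported K G by move=> x Kx; rewrite /G FK// expr0n/= !mulr0 subrr.
have cpX : continuous (fun x => p x * expR (V x)).
  by apply/class_C0; apply: class_CM => //; exact/class_C0.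
apply: (@integrable_itv_bound _ (\int[mu]_x G x)).
- exact: (energy_continuous kE E0 cu cd).
- by move=> x; exact: energy_ge0.
- move=> k Kk.
  rewrite (@Rintegral_supported _ mu G K (- k) k GK) ?lerN2 ?(ltW Kk)//.
  rewrite (@eq_Rintegral _ _ _ mu _ (fun x => p x * expR (V x) + G x)) => [|x _]; last exact: eE.
  rewrite RintegralD//; [|exact: itv_integrable|exact: itv_integrable].
  rewrite gerDr /Rintegral.
  have k0 : 0 < k by exact: lt_trans Kk.
  have dp x : isd x (fun x => y x * th x) (p x) by exact: sys_prod h.
  have nk : - k < k by lra.
  rewrite (mu_FTC cV muE nk dp cp)/=.
  by rewrite subr_le0 (le_trans (right_tail Kk))// left_tail// ltrN2.
Qed.

Let beta := plateau K.
Let beta' := derive1 beta.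
Let dbeta x : isd x beta (beta' x).
Proof. exact: class_C_is_derive (plateau_class_C K 1). Qed.

Let th' x := expR (- V x) * (E x * y x - F x).
(** The cut-off [chi k] built on [r] is 0 where [k * r <= 1] and 1 where [k * r >= 2]. Its
    derivative involves [th' = - expR (- V) * d], hence is comparable to [d]. The term [beta ^+ 2]
    keeps [r] positive on [[-K, K]], where [th] may vanish at points with [d] nonzero. *)
Let r x := th x ^+ 2 + beta x ^+ 2.
Let r' x := 2 * th x * th' x + 2 * beta x * beta' x.
Let S' : R -> R := derive1 step.

Let dr x : isd x r (r' x).
Proof. by rewrite /r /r'; der (first [exact: h.2 | exact: dbeta]); rewrite /th' /=; ring. Qed.

Let dS x : isd x step (S' x).
Proof. exact: class_C_is_derive (step_class_C 1). Qed.

Let S'_eq0 t : 1 < t -> S' t = 0.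
Proof.
move=> t1; rewrite /S'; apply: isd_val; apply: isd_near (isd_cst 1 t).
by apply: filterS (lt_nbhsr t1) => z z1; rewrite step_eq1// ltW.
Qed.

Let cS' : continuous S'.
Proof. exact: class_C_continuous (class_C_derive1 (step_class_C 1)). Qed.

Let S'_bounded : exists2 M, 0 < M & forall t, `|S' t| <= M.
Proof.
apply: (@supported_bounded _ _ 1) => // t; rewrite lter_normr => /orP[]; first exact: S'_eq0.
move=> t1; rewrite /S'; apply: isd_val; apply: isd_near (isd_cst 0 t).
have t0 : t < 0 by lra.
by apply: filterS (lt_nbhsl t0) => z z1; rewrite step_eq0// ltW.
Qed.

Let chi k x := step (k * r x - 1).
Let v k x := u x * chi k x.
Let v' k x := (V1 x * u x - d x) * chi k x + u x * (S' (k * r x - 1) * (k * r' x)).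

Let dchi k x : isd x (chi k) (S' (k * r x - 1) * (k * r' x)).
Proof.
apply: (@isd_comp _ step (fun x => k * r x - 1)); first exact: dS.
by der (exact: dr); ring.
Qed.

Let dv k x : isd x (v k) (v' k x).
Proof. by apply: isdM; [exact: du|exact: dchi]. Qed.

Let cr : class_C 0 r. Proof. exact/class_C0/(isd_continuous dr). Qed.

Let cr' : class_C 0 r'.
Proof.
have ky : class_C 0 y by exact/class_C0.
have kth : class_C 0 th by exact/class_C0.
have kb : class_C 0 beta by exact: plateau_class_C.
have kb' : class_C 0 beta' by exact: class_C_derive1 (plateau_class_C K 1).
have kth' : class_C 0 th'.
  apply: class_CM; first by apply/class_C_expR/class_CN/class_C0.
  by apply: class_CB; [apply: class_CM => //; exact: class_CW kE|exact: class_CW kF].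
apply: class_CD; apply: class_CM => //; apply: class_CM => //; exact: class_C_cst.
Qed.

Let cv' k : continuous (v' k).
Proof.
have kt : class_C 0 (fun x => k * r x - 1).
  by apply: class_CB; [apply: class_CM => //; exact: class_C_cst|exact: class_C_cst].
have kS : class_C 0 (fun x => S' (k * r x - 1)).
  apply/class_C0 => x; apply: (@continuous_comp _ _ _ (fun x => k * r x - 1) S').
    by move/class_C0 : kt; exact.
  exact: cS'.
apply/class_C0/class_CD.
  apply: class_CM; last exact/class_C0/(isd_continuous (dchi k)).
  apply: class_CB; last exact/class_C0.
  by apply: class_CM; [exact: class_CW kV1|exact/class_C0].
apply: class_CM; first exact/class_C0.
by apply: class_CM => //; apply: class_CM => //; exact: class_C_cst.
Qed.

(** Off [[-K, K]] a zero of [th] is an extremum of [y * th], which has constant sign on that tail;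
    the derivative, there reduced to [expR (- V x) * (E x * y x ^+ 2)], must vanish. So no energy
    sits at the points that the cut-off never releases. *)
Let near_null (x : R) : r x = 0 -> th x = 0 /\ d x = 0.
Proof.
move=> /eqP; rewrite paddr_eq0 ?sqr_ge0// !sqrf_eq0 => /andP[/eqP t0 /eqP b0].
split=> //; have xK : K < `|x|.
  rewrite ltNge; apply/negP => xK; move: b0; rewrite /beta plateau_eq1// => /eqP.
  by rewrite oner_eq0.
have dp (z : R) := sys_prod z h.
have p0 : y x * th x = 0 by rewrite t0 mulr0.
suff : E x * y x ^+ 2 = 0.
  move=> /eqP; rewrite mulf_eq0 (negbTE (En0 x))/= sqrf_eq0 => /eqP y0.
  by rewrite /d FK// y0 mulr0 subr0.
suff : expR (V x) * th x ^+ 2 + expR (- V x) * (E x * y x ^+ 2 - y x * F x) = 0.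
  rewrite t0 FK// expr0n/= !mulr0 subr0 add0r => /eqP.
  by rewrite mulf_eq0 expR_eq0/= => /eqP.
move: xK; rewrite lter_normr => /orP[xK|xK].
  have x1 : K < x + 1 by lra.
  have H : is_derive x 1 (fun z => y z * th z) 0.
    apply: (@derive1_at_max _ _ K (x + 1)).
    - exact: ltW.
    - by move=> t _; exact: isd_derivable (dp t).
    - by rewrite in_itv/= xK/= ltrDl.
    - by move=> t; rewrite in_itv/= p0 => /andP[Kt _]; exact: right_tail.
  by rewrite -(isd_val (dp x)) (isd_val H).
have x1 : x - 1 < - K by lra.
have H : is_derive x 1 (fun z => y z * th z) 0.
  apply: (@derive1_at_min _ _ (x - 1) (- K)).
  - exact: ltW.
  - by move=> t _; exact: isd_derivable (dp t).
  - by rewrite in_itv/= gtrBl ltr01 ltrNr.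
  - by move=> t; rewrite in_itv/= p0 => /andP[_ Kt]; exact: left_tail.
by rewrite -(isd_val (dp x)) (isd_val H).
Qed.

Let vd k x := V1 x * v k x - v' k x.

Let cvd k : continuous (vd k).
Proof.
apply/class_C0/class_CB; last exact/class_C0/cv'.
apply: class_CM; first exact: class_CW kV1.
exact/class_C0/(isd_continuous (dv k)).
Qed.

(** The majorant for dominated convergence. Where [S'] may be nonzero, [k * r x <= 2], hence
    [k * th x ^+ 2 <= 2] and [k * |th x * beta x| <= 1]: the factor [k] from the derivative of the
    cut-off is absorbed, leaving multiples of [|d|] and of a compactly supported function. *)
Let cutoff_bound : exists2 G, mu.-integrable setT (EFin \o G) &
  forall (n : nat) x, energy E (u \- v n%:R) (d \- vd n%:R) x <= G x.
Proof.
have [M M0 SM] := S'_bounded.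
(* [4 * M] bounds [|S'|] times [2 * (k * th x ^+ 2)]; the summand 1 is for [d * (1 - chi k)], and
   the outer 2 comes from [(a + b)^2 <= 2 a^2 + 2 b^2]. *)
pose c := 2 * (1 + 4 * M) ^+ 2.
pose b x := 2 * ((E x)^-1 * (4 * M * (expR (V x) * beta' x)) ^+ 2).
have cb : continuous b.
  apply/class_C0/class_CM; first exact: class_C_cst.
  apply: class_CM; first exact: class_CW kEV.
  apply: class_CX; apply: class_CM; first exact: class_C_cst.
  apply: class_CM; first by apply/class_C_expR/class_C0.
  exact: class_C_derive1 (plateau_class_C K 1).
have b'K : supported (K + 1) beta' := supported_isd dbeta (@plateau_supported _ K).
have bK : supported (K + 1) b by move=> x /b'K b0; rewrite /b b0 !(mulr0, expr0n).
have ib : mu.-integrable setT (EFin \o b) by exact: supported_integrable bK.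
have [_ _ iu] := fe_u.
exists (fun x => c * energy E u d x + b x).
  have := integrableD measurableT (integrableZl measurableT c iu) ib.
  by [].
move=> n x; set k : R := n%:R; have k0 : 0 <= k by rewrite ler0n.
have s0 := step_ge0 (k * r x - 1); have s1 := step_le1 (k * r x - 1).
have uv : (u x - v k x) ^+ 2 <= u x ^+ 2.
  have -> : u x - v k x = u x * (1 - chi k x) by rewrite /v; ring.
  rewrite exprMn ler_piMr ?sqr_ge0// expr_le1 ?subr_ge0//.
  by rewrite gerBl.
have dvE : d x - vd k x = d x * (1 - chi k x) + u x * (S' (k * r x - 1) * (k * r' x)).
  by rewrite /vd /v' /v; ring.
have key : `|u x * (S' (k * r x - 1) * (k * r' x))| <=
    4 * M * `|d x| + 4 * M * `|expR (V x) * beta' x|.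
  have [t1|t1] := leP (k * r x - 1) 1; last first.
    by rewrite S'_eq0// mul0r mulr0 normr0 addr_ge0// !mulr_ge0// ltW.
  have eth : expR (V x) * th' x = - d x.
    by rewrite /th' /d expRN mulrA divff ?expR_eq0//; ring.
  have k1 : k * th x ^+ 2 <= 2.
    have : k * th x ^+ 2 <= k * r x by rewrite ler_wpM2l// /r lerDl sqr_ge0.
    by lra.
  have k2 : k * `|th x * beta x| <= 1.
    have : 2 * `|th x * beta x| <= r x.
      rewrite /r -(real_normK (num_real (th x))) -(real_normK (num_real (beta x))).
      rewrite normrM -subr_ge0 (_ : _ - _ = (`|th x| - `|beta x|) ^+ 2) ?sqr_ge0//.
      by ring.
    by move=> /(ler_wpM2l k0); lra.
  have -> : u x * (S' (k * r x - 1) * (k * r' x)) = S' (k * r x - 1) *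
     (- (2 * (k * th x ^+ 2)) * d x + 2 * (k * (th x * beta x)) * (expR (V x) * beta' x)).
    rewrite -[d x]opprK -eth /u /r'; ring.
  rewrite normrM; apply: (@le_trans _ _ (M * (4 * `|d x| + 4 * `|expR (V x) * beta' x|))).
    apply: ler_pM => //; apply: (le_trans (ler_normD _ _)); apply: lerD.
      rewrite normrM ler_wpM2r// normrN ger0_norm; first lra.
      by do 2 (apply: mulr_ge0 => //); exact: sqr_ge0.
    rewrite normrM ler_wpM2r// normrM (ger0_norm (ler0n _ 2)) normrM (ger0_norm k0).
    by lra.
  by rewrite le_eqVlt; apply/orP; left; apply/eqP; ring.
have dd : (d x - vd k x) ^+ 2 <=
    2 * ((1 + 4 * M) ^+ 2 * d x ^+ 2) + 2 * (4 * M * (expR (V x) * beta' x)) ^+ 2.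
  have : `|d x - vd k x| <= (1 + 4 * M) * `|d x| + 4 * M * `|expR (V x) * beta' x|.
    rewrite dvE (le_trans (ler_normD _ _))//.
    have -> : (1 + 4 * M) * `|d x| + 4 * M * `|expR (V x) * beta' x| =
      `|d x| + (4 * M * `|d x| + 4 * M * `|expR (V x) * beta' x|) by ring.
    rewrite lerD//.
    rewrite normrM ler_piMr// ger0_norm ?subr_ge0//.
    by rewrite gerBl.
  move=> A; rewrite -(real_normK (num_real (d x - vd k x))).
  have A2 : `|d x - vd k x| ^+ 2 <=
      ((1 + 4 * M) * `|d x| + 4 * M * `|expR (V x) * beta' x|) ^+ 2.
    by rewrite ler_pXn2r ?nnegrE// (le_trans _ A).
  apply: (le_trans A2).
  rewrite -(real_normK (num_real (d x))).
  rewrite [(4 * M * (expR (V x) * beta' x)) ^+ 2]exprMn.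
  rewrite -(real_normK (num_real (expR (V x) * beta' x))).
  move: `|d x| `|expR (V x) * beta' x| => p1 p2.
  by rewrite -subr_ge0 (_ : _ - _ = ((1 + 4 * M) * p1 - 4 * M * p2) ^+ 2) ?sqr_ge0//; ring.
have w0 : 0 <= (E x)^-1 by rewrite invr_ge0 ltW.
have c1 : 1 <= c by rewrite /c; nra.
have := ler_wpM2l w0 dd; rewrite /energy /b /c /=.
have : u x ^+ 2 <= 2 * (1 + 4 * M) ^+ 2 * u x ^+ 2 by rewrite ler_peMl ?sqr_ge0.
move: uv; set a1 := (u x - v k x) ^+ 2; set a2 := (E x)^-1 * (d x - vd k x) ^+ 2.
by rewrite !mulrDr; nra.
Qed.

(** Either [r x = 0], and [u], [d] both vanish by [near_null], or [n * r x > 2] for large [n], where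
    the cut-off is 1 with zero derivative. *)
Let cutoff_cvg0 x : exists N : nat, forall n : nat, (N <= n)%N ->
  energy E (u \- v n%:R) (d \- vd n%:R) x = 0.
Proof.
have [r0|rn0] := eqVneq (r x) 0.
  have [t0 d0] := near_null r0; have u0 : u x = 0 by rewrite /u t0 mulr0.
  exists 0%N => n _; rewrite /energy /= /vd /v' /v u0 d0.
  by rewrite !(mul0r, mulr0, subr0, addr0) expr0n/= mulr0 addr0.
have rp : 0 < r x by rewrite lt_neqAle eq_sym rn0 addr_ge0 ?sqr_ge0.
exists (Num.trunc (2 / r x)).+1 => n nN.
have t1 : 1 < n%:R * r x - 1.
  have : 2 / r x < n%:R by apply: (lt_le_trans (truncnS_gt _)); rewrite ler_nat.
  by rewrite ltr_pdivrMr//; lra.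
rewrite /energy /= /vd /v' /v S'_eq0// /chi step_eq1 ?(ltW t1)//.
by ring.
Qed.

Let cutoff_supported n : exists2 L, 0 < L & supported L (v n%:R).
Proof.
(* From [|th x| < 1/(n+1)] follows [n * th x ^+ 2 <= 1], where [step] vanishes; the successor keeps
   [n = 0] meaningful. *)
have n0 : 0 < n.+1%:R^-1 :> R by rewrite invr_gt0.
have [X HX] := decay n0.
exists (Num.max X (K + 1)); first by rewrite lt_max addr_gt0// orbT.
move=> x; rewrite gt_max => /andP[/HX tx xK].
rewrite /v /chi step_eq0 ?mulr0// subr_le0 /r /beta plateau_supported// expr0n/= addr0.
rewrite -(real_normK (num_real (th x))).
apply: (@le_trans _ _ (n.+1%:R * (n.+1%:R^-1) ^+ 2)).
  by rewrite ler_pM ?sqr_ge0// ?ler_nat// ler_pXn2r ?nnegrE// ltW.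
by rewrite expr2 mulrA divff ?mul1r ?pnatr_eq0// invf_le1 ?ler1n.
Qed.

Let cutoff e : 0 < e -> exists n : nat,
  \int[mu]_x energy E (u \- v n%:R) (d \- vd n%:R) x <= e.
Proof.
move=> e0; have [G iG HG] := cutoff_bound.
have cen (n : nat) : continuous (energy E (u \- v n%:R) (d \- vd n%:R)).
  apply: (energy_continuous kE E0); apply/class_C0/class_CB.
  - exact/class_C0/cu.
  - exact/class_C0/(isd_continuous (dv n%:R)).
  - exact/class_C0/cd.
  - exact/class_C0/cvd.
have men (n : nat) : measurable_fun setT
    (EFin \o energy E (u \- v n%:R) (d \- vd n%:R)).
  by apply/measurable_EFinP; exact: continuous_measurableT.
have [] := @dominated_convergence _ _ _ mu setT measurableT
  (fun n => EFin \o energy E (u \- v n%:R) (d \- vd n%:R)) (cst 0%E) (EFin \o G).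
- exact: men.
- exact: measurable_cst.
- apply: aeW => x _; have [N HN] := cutoff_cvg0 x.
  apply: cvg_near_cst; exists N => // n /= /HN en0.
  by rewrite /= en0.
- exact: iG.
- apply: aeW => x n _ /=; rewrite lee_fin ger0_norm ?HG//.
  exact: energy_ge0.
move=> _ _; rewrite integral0 => /fine_cvgP[_ /cvgrPdist_lt /(_ e e0)[N _ HN]].
exists N; have := HN N (leqnn N); rewrite /= sub0r normrN => /ltW.
by apply: le_trans; exact: ler_norm.
Qed.

Lemma sys_form_dom : form_dom mu C (fun phi => \int[mu]_x ((E x)^-1 * (Dstar V phi x) ^+ 2)) u.
Proof.
apply: (form_domI kV kE E0 fe_u) => e e0.
(* One share for truncation and one for mollification, each doubled by [energy_sub_le]. *)
have e4 : 0 < e / 4 by rewrite divr_gt0.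
have [n Hn] := cutoff e4.
have [L L0 vL] := cutoff_supported n.
have [phi Cphi Hphi] := mollify_energy mu kV kE E0 L0 (dv n%:R) (@cv' n%:R) vL e4.
exists phi => //.
have -> : phi \- u = (phi \- v n%:R) \- (u \- v n%:R) by apply/funext => x /=; ring.
have -> : Dstar V phi \- d = (Dstar V phi \- vd n%:R) \- (d \- vd n%:R).
  by apply/funext => x /=; ring.
have fv : finite_energy E mu (v n%:R) (vd n%:R).
  apply: (@supported_finite_energy _ E mu kE E0 _ _ L) => //.
    exact: isd_continuous (dv n%:R).
  by move=> x Lx; rewrite /vd vL// (supported_isd (dv n%:R) vL)// mulr0 subr0.
have fphi := test_finite_energy mu kV kE E0 Cphi.
rewrite (le_trans (Rintegral_energy_sub_le kE E0 (finite_energy_sub kE E0 fphi fv)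
  (finite_energy_sub kE E0 fe_u fv)))//.
by move: Hphi; rewrite -/(vd _); lra.
Qed.

Let W x := (E x)^-1 * F x.

(** Formally [D E^-1 Dstar u = D (E^-1 d) = D (W - y) = g - u]. In the weak form, the test function
    is integrated by parts against [W - y]. *)
Lemma sys_form_op (g := derive1 W) :
  L2 g /\ form_op mu C (fun phi => \int[mu]_x ((E x)^-1 * (Dstar V phi x) ^+ 2)) u (g \- u).
Proof.
have kW : class_C 1 W by exact: class_CM kEV kF.
have cg : continuous g by exact: class_C_continuous (class_C_derive1 kW).
have dW x : isd x W (g x) by exact: class_C_is_derive kW.
have gK : supported K g by apply: (supported_isd dW); exact: supportedMr.
have Lg : L2 g by exact: supported_L2 gK.
have SL := L2_semi_inner mu.
have Lu : L2 u by exact: (finite_energy_L2 E0 fe_u).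
have Lgu : L2 (g \- u) by exact: (si_subc SL).
split=> //.
apply: (form_op_intro (bform_semi_inner mu kV kE E0)) => //.
- by move=> phi; exact: bform_diag.
- exact: test_L2.
- exact: (bform_reprC kV kE E0 muE).
- exact: sys_form_dom.
move=> phi Cphi; have [La ra Ha] := bform_repr kV kE E0 muE Cphi.
have [kphi [L L0 pL]] := test_supported Cphi.
eexists; split; [exact: La|exact: ra|].
have cu' : continuous (fun x => V1 x * u x - d x).
  apply/class_C0/class_CB; last exact/class_C0.
  by apply: class_CM; [exact: class_CW kV1|exact/class_C0].
rewrite (Ha u _ du cu').
have dphi x : isd x phi (derive1 phi x) by exact: class_C_is_derive (kphi 1%N).
have cphi' : continuous (derive1 phi) by exact: class_C_continuous (class_C_derive1 (kphi 1%N)).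
have dWy x : isd x (fun z => W z - y z) (g x - u x).
  by apply: isdD; [exact: dW|apply: isdN; exact: h.1].
have cgu : continuous (fun x => g x - u x) by apply/class_C0/class_CB; exact/class_C0.
have := mu_int_parts kV muE dphi dWy cphi' cgu (or_introl pL).
rewrite /L2inner => parts.
transitivity (\int[mu]_x (phi x * (g x - u x))); last first.
  by apply: eq_Rintegral => x _; rewrite mulrC.
rewrite parts; apply: eq_Rintegral => x _; rewrite (Dstar_isd _ dphi) /W /d.
by field.
Qed.

End Resolvent.

(** * Regularity and supports of [Eseq] and [fseq] *)

Section Regularity.
Context {R : realType}.
Implicit Types V E f : R -> R.

Lemma supported_derive1 K f : supported K f -> supported K (derive1 f).
Proof.
move=> fK x Kx; apply: isd_val; apply: isd_near (isd_cst 0 x).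
have /cvgr_gt := @norm_continuous R R^o x.
by move=> /(_ K Kx); apply: filterS => y /fK ->.
Qed.

Lemma calA_class_C k V E : (forall x, 0 < E x) -> class_C k.+2 V -> class_C k.+2 E ->
  class_C k (calA V E).
Proof.
move=> E0 kV kE; have En0 x : E x != 0 by rewrite gt_eqF.
have kV1 : class_C k (derive1 V) := class_CW (leqnSn k) (class_C_derive1 kV).
have kE1 : class_C k (derive1 E) := class_CW (leqnSn k) (class_C_derive1 kE).
have kE0 : class_C k E by apply: class_CW kE; lia.
have k2 (g : R -> R) : class_C k.+2 g -> class_C k (derive1n 2 g).
  by move=> kg; apply: class_C_derive1n; rewrite addn2.
have c k' (a : R) : class_C k' (fun=> a) := class_C_cst k' a.
apply: class_CM (c _ _) _; apply: class_CD; first apply: class_CB.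
- apply: class_CD; first exact: class_CM (c _ _) (k2 _ kE).
  exact: class_CM (class_CM (c _ _) kV1) kE1.
- exact: class_CM (class_CX 2 kE1) (class_CV En0 kE0).
- exact: class_CM (class_CM (c _ _) kE0) (k2 _ kV).
Qed.

Lemma EseqS V k : Eseq V k.+2 =
  fun x => Eseq V k.+1 x * (1 + calA V (fun y => (Eseq V k.+1 y)^-1) x).
Proof. by []. Qed.

(** Each rank costs two derivatives through [calA]: from [V''] of class [C^(2n-1)], the count leaves
    exactly [C^1] for [Eseq V n], which is what the resolvent asks of [E]. *)
Lemma Eseq_class_C n V : class_C (2 * n + 1) V ->
  (forall j, (1 <= j <= n)%N -> forall x, 0 < Eseq V j x) ->
  forall j, (1 <= j <= n)%N -> class_C (2 * (n - j) + 1) (Eseq V j).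
Proof.
move=> kV E0; case=> // j; elim: j => [|j IH] jn.
  by apply: class_C_derive1n; apply: class_CW kV; lia.
have jn' : (1 <= j.+1 <= n)%N by lia.
rewrite EseqS; have kE := IH jn'; have {}E0 := E0 _ jn'.
apply: class_CM; first by apply: class_CW kE; lia.
apply: class_CD; first exact: class_C_cst.
apply: calA_class_C; first by move=> x; rewrite invr_gt0.
- by apply: class_CW kV; lia.
- apply: class_CV; first by move=> x; rewrite gt_eqF.
  by apply: class_CW kE; lia.
Qed.

Lemma fseqS V f k : fseq V f k.+2 =
  fun x => Num.sqrt (Eseq V k.+1 x) * D_Einv (Eseq V k.+1) (fseq V f k.+1) x.
Proof. by []. Qed.

Lemma fseq_class_C n V f : class_C (2 * n + 1) V -> class_C n.+1 f ->
  (forall j, (1 <= j <= n)%N -> forall x, 0 < Eseq V j x) ->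
  forall j, (1 <= j <= n)%N -> class_C (n.+1 - j) (fseq V f j).
Proof.
move=> kV kf E0; case=> // j; elim: j => [|j IH] jn.
  by rewrite subn1; exact: class_C_derive1 kf.
have jn' : (1 <= j.+1 <= n)%N by lia.
rewrite fseqS; have kE := Eseq_class_C kV E0 jn'; have {}E0 := E0 _ jn'.
apply: class_CM.
  by apply: class_C_sqrt => //; apply: class_CW kE; lia.
apply: class_C_derive1; apply: class_CM.
  apply: class_CV; first by move=> x; rewrite gt_eqF.
  by apply: class_CW kE; lia.
by apply: class_CW (IH jn'); lia.
Qed.

Lemma fseq_supported K V f j : supported K f -> supported K (fseq V f j).
Proof.
move=> fK; elim: j => [//|[|j] IH]; first exact: supported_derive1.
rewrite fseqS; apply: supportedMr; apply: supported_derive1; exact: supportedMr.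
Qed.

End Regularity.

Local Notation hom V E := (sys V E (fun=> 0)).

(** * The chain of solutions from one rank to the next *)

Section Chain.
Context {R : realType} (V : R -> R).
Local Notation V1 := (derive1 V).

(** The pair of the next rank: [E^(-1/2) y'], and [expR (- V)] times its derivative, where [th'] has
    been eliminated by the equation. In [p] and [F], only the values at [x] enter, and linearly. *)
Definition next (E F : R -> R) (p : (R -> R) * (R -> R)) : (R -> R) * (R -> R) :=
  let s x := (Num.sqrt (E x))^-1 in
  (fun x => s x * expR (V x) * p.2 x,
   fun x => (derive1 s x + s x * V1 x) * p.2 x +
     expR (- V x) * (Num.sqrt (E x) * p.1 x - s x * F x)).

(* [chain Fs p k] solves the equation of rank [k.+1], with right-hand side
   [Fs k.+1], when [p] solves the one of rank 1 *)
Fixpoint chain (Fs : nat -> R -> R) p (k : nat) :=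
  if k is j.+1 then next (Eseq V k) (Fs k) (chain Fs p j) else p.

(** When [Phi' = - a * expR (- V)], the first component [y] satisfies [Dstar V y = a], hence
    [D Dstar y = a'], the equation of rank 1; the second is [expR (- V) * y']. *)
Definition start (Phi a : R -> R) : (R -> R) * (R -> R) :=
  (fun x => expR (V x) * Phi x, fun x => V1 x * Phi x - expR (- V x) * a x).

Lemma start_sys (Phi a a1 : R -> R) : class_C 2 V ->
  (forall x, isd x Phi (- a x * expR (- V x))) -> (forall x, isd x a (a1 x)) ->
  sys V (Eseq V 1) a1 (start Phi a).1 (start Phi a).2.
Proof.
move=> kV dPhi da.
have dV x : isd x V (V1 x) by exact: class_C_is_derive kV.
have dV1 x : isd x V1 (Eseq V 1 x) := class_C_is_derive x (class_C_derive1 kV).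
split=> x /=.
  der (first [exact: dV | exact: dPhi]).
  by rewrite expRN; field; rewrite expR_eq0.
der (first [exact: dV | exact: dV1 | exact: dPhi | exact: da]).
by rewrite expRN; field; rewrite expR_eq0.
Qed.

(** Written with [s = E^(-1/2)], the quotient in [calA] cancels:
    [calA V (s^2) = s (s'' + V' s' + V'' s)], which identifies the potential of [sys_next] with that
    of the next rank. *)
Lemma next_sys (E F : R -> R) p : class_C 2 V -> class_C 2 E -> (forall x, 0 < E x) ->
  class_C 1 F -> sys V E F p.1 p.2 ->
  sys V (fun x => E x * (1 + calA V (fun y => (E y)^-1) x))
    (fun x => Num.sqrt (E x) * D_Einv E F x) (next E F p).1 (next E F p).2.
Proof.
move=> kV kE E0 kF h; pose t x := Num.sqrt (E x); pose s x := (t x)^-1.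
have t0 x : t x != 0 by rewrite gt_eqF// sqrtr_gt0.
have kt : class_C 2 t by exact: class_C_sqrt.
have ks : class_C 2 s by exact: class_CV.
have ds x : isd x s (derive1 s x) by exact: class_C_is_derive ks.
have ds1 x : isd x (derive1 s) (derive1 (derive1 s) x).
  exact: class_C_is_derive (class_C_derive1 ks).
have tE : (fun x => (s x)^-1) = t by apply/funext => x; rewrite /s invrK.
have s0 x : s x != 0 by rewrite invr_eq0.
have dt x : isd x t (- (t x ^+ 2 * derive1 s x)).
  rewrite -tE; apply: isd_eq; first exact: isdV (s0 x) (ds x).
  by rewrite /s; field.
have Et x : E x = t x ^+ 2 by rewrite sqr_sqrtr// ltW.
have sE : (fun x => (E x)^-1) = fun x => s x ^+ 2.
  by apply/funext => x; rewrite Et -exprVn.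
have dE x : isd x (fun x => s x ^+ 2) (2 * s x * derive1 s x).
  by der (exact: ds); rewrite expr1.
have dE1 x : isd x (fun x => 2 * s x * derive1 s x)
    (2 * derive1 s x ^+ 2 + 2 * s x * derive1 (derive1 s) x).
  by der (first [exact: ds | exact: ds1]); ring.
have d1 : derive1 (fun x => (E x)^-1) = fun x => 2 * s x * derive1 s x.
  by rewrite sE; exact: isd_fun.
have d2 : derive1n 2 (fun x => (E x)^-1) =
    fun x => 2 * derive1 s x ^+ 2 + 2 * s x * derive1 (derive1 s) x.
  by rewrite derive1nS derive1n1 d1; exact: isd_fun.
have dF x : isd x F (derive1 F x) by exact: class_C_is_derive kF.
have dV x : isd x V (V1 x) by exact: class_C_is_derive kV.
have dV1 x : isd x V1 (derive1 V1 x) := class_C_is_derive x (class_C_derive1 kV).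
have ts x : t x * s x = 1 by rewrite divff.
have := sys_next dV dV1 ds ds1 dt ts Et dF h.
rewrite (_ : (fun x => t x ^+ 2 + _) = fun x => E x * (1 + calA V (fun y => (E y)^-1) x)).
  rewrite (_ : (fun x => 2 * derive1 s x * F x + _) = fun x => t x * D_Einv E F x)//.
  have -> : D_Einv E F = derive1 (fun y => s y ^+ 2 * F y).
    by congr derive1; apply/funext => y; rewrite Et -exprVn.
  apply/funext => x; rewrite (isd_val (isdM (dE x) (dF x))) /s.
  by field.
apply/funext => x; rewrite /calA d1 d2 Et derive1nS derive1n1.
rewrite (_ : s x = (t x)^-1)//; move: (t0 x); move: (t x) (derive1 s x) => a b.
move: (derive1 (derive1 s) x) (V1 x) (derive1 V1 x) => c e g a0.
by field.
Qed.

Lemma chain_sys n Fs p : class_C (2 * n + 1) V ->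
  (forall j, (1 <= j <= n)%N -> forall x, 0 < Eseq V j x) ->
  (forall j, (1 <= j <= n)%N -> class_C 1 (Fs j)) ->
  (forall k, Fs k.+2 = fun x => Num.sqrt (Eseq V k.+1 x) * D_Einv (Eseq V k.+1) (Fs k.+1) x) ->
  sys V (Eseq V 1) (Fs 1%N) p.1 p.2 -> forall k, (k < n)%N ->
  sys V (Eseq V k.+1) (Fs k.+1) (chain Fs p k).1 (chain Fs p k).2.
Proof.
move=> kV E0 kFs FsS h; elim=> [//|k IH] kn.
have jn : (1 <= k.+1 <= n)%N by lia.
rewrite EseqS FsS; apply: next_sys; [..|by apply: IH; lia].
- by apply: class_CW kV; lia.
- by apply: class_CW (Eseq_class_C kV E0 jn); lia.
- exact: E0.
- exact: kFs.
Qed.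

(** Where all right-hand sides vanish, each rank is a pointwise linear function of the initial pair.
    It is applied outside the support of [f], to compare with a chain that is homogeneous on the
    whole line. *)
Lemma chain_local (Fs Gs : nat -> R -> R) p p' (c x : R) k :
  (forall j, Fs j x = 0) -> (forall j, Gs j x = 0) ->
  p.1 x = c * p'.1 x -> p.2 x = c * p'.2 x ->
  (chain Fs p k).1 x = c * (chain Gs p' k).1 x /\
  (chain Fs p k).2 x = c * (chain Gs p' k).2 x.
Proof.
move=> F0 G0 p1 p2; elim: k => [//|k [IH1 IH2]].
by rewrite /= IH1 IH2 F0 G0; split; ring.
Qed.

Let zero (j : nat) (x : R) : R := 0.

(** Keeps the Wronskian nonzero at all ranks, as [sys_dominated] requires. *)
Lemma next_wronskian (E : R -> R) p p' x : (forall x, 0 < E x) ->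
  (next E (fun=> 0) p).1 x * (next E (fun=> 0) p').2 x -
  (next E (fun=> 0) p).2 x * (next E (fun=> 0) p').1 x =
  - (p.1 x * p'.2 x - p.2 x * p'.1 x).
Proof.
move=> E0; rewrite /= expRN.
have t0 : Num.sqrt (E x) != 0 by rewrite gt_eqF// sqrtr_gt0.
by field; rewrite t0 expR_eq0.
Qed.

Section Recessive.
Variables (n : nat) (p p' : (R -> R) * (R -> R)).
Hypothesis kV : class_C (2 * n + 1) V.
Hypothesis E0 : forall j, (1 <= j <= n)%N -> forall x, 0 < Eseq V j x.
Hypothesis hp : sys V (Eseq V 1) (fun=> 0) p.1 p.2.
Hypothesis hp' : sys V (Eseq V 1) (fun=> 0) p'.1 p'.2.
Hypothesis W : forall x, p.1 x * p'.2 x - p.2 x * p'.1 x != 0.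

Let zeroS k : zero k.+2 =
  fun x => Num.sqrt (Eseq V k.+1 x) * D_Einv (Eseq V k.+1) (zero k.+1) x.
Proof.
apply/funext => x; rewrite /D_Einv /zero (_ : (fun y => _) = fun=> 0).
  by rewrite (isd_val (isd_cst 0 x)) mulr0.
by apply/funext => y; rewrite mulr0.
Qed.

Let hyp k : (k < n)%N -> hom V (Eseq V k.+1) (chain zero p k).1 (chain zero p k).2.
Proof.
apply: (@chain_sys n zero) => // j _; exact: class_C_cst.
Qed.

Let hyp' k : (k < n)%N -> hom V (Eseq V k.+1) (chain zero p' k).1 (chain zero p' k).2.
Proof.
apply: (@chain_sys n zero) => // j _; exact: class_C_cst.
Qed.

Let chain_W k : (k < n)%N -> forall x,
  (chain zero p k).1 x * (chain zero p' k).2 x -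
  (chain zero p k).2 x * (chain zero p' k).1 x != 0.
Proof.
elim: k => [_|k IH kn] x; first exact: W.
rewrite next_wronskian ?oppr_eq0; first by apply: IH; lia.
by apply: E0; lia.
Qed.

(** The next first component is [th] times a positive factor: domination of [th] is domination of
    the next [y], which closes the induction. *)
Let next_scale (E F F' : R -> R) (q q' : (R -> R) * (R -> R)) (x e : R) : (forall x, 0 < E x) ->
  `|q.2 x| < e * `|q'.2 x| ->
  `|(next E F q).1 x| < e * `|(next E F' q').1 x|.
Proof.
move=> Ep; rewrite /= (normrM _ (q.2 x)) (normrM _ (q'.2 x)).
rewrite [X in _ -> _ < X]mulrCA ltr_pM2l// normr_gt0.
by rewrite mulf_neq0 ?expR_eq0// invr_eq0 gt_eqF// sqrtr_gt0.
Qed.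

Lemma chain_recessive_right : bounded_below_right V -> dominated p.1 p'.1 ->
  forall k, (k < n)%N ->
  (forall x, (chain zero p k).1 x * (chain zero p k).2 x <= 0) /\
  (forall e, 0 < e -> exists X, forall x, X < x -> `|(chain zero p k).2 x| < e).
Proof.
move=> Vb D.
have key k : (k < n)%N -> dominated (chain zero p k).1 (chain zero p' k).1.
  elim: k => [//|k IH] kn; have kn' : (k < n)%N by lia.
  have Ep : forall x, 0 < Eseq V k.+1 x by apply: E0; lia.
  have th := sys_dominated Ep Vb (hyp kn') (hyp' kn') (chain_W kn') (IH kn').
  by move=> e /th[X HX]; exists X => x /HX; exact: next_scale.
move=> k kn; have Ep : forall x, 0 < Eseq V k.+1 x by apply: E0; lia.
have le0 := dominated_sys_prod_le0 Ep (hyp kn) (hyp' kn) (key k kn).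
by split => //; exact: sys_decay Ep Vb (hyp kn) le0.
Qed.

Lemma chain_recessive_left : bounded_below_right (fun x => V (- x)) ->
  dominated (fun x => p.1 (- x)) (fun x => p'.1 (- x)) ->
  forall k, (k < n)%N ->
  (forall x, 0 <= (chain zero p k).1 x * (chain zero p k).2 x) /\
  (forall e, 0 < e -> exists X, forall x, X < x -> `|(chain zero p k).2 (- x)| < e).
Proof.
move=> Vb D.
have key k : (k < n)%N ->
    dominated (fun x => (chain zero p k).1 (- x)) (fun x => (chain zero p' k).1 (- x)).
  elim: k => [//|k IH] kn; have kn' : (k < n)%N by lia.
  have Ep : forall x, 0 < Eseq V k.+1 x by apply: E0; lia.
  have Wr x : (chain zero p k).1 (- x) * - (chain zero p' k).2 (- x) -
      - (chain zero p k).2 (- x) * (chain zero p' k).1 (- x) != 0.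
    by rewrite mulrN mulNr -opprD oppr_eq0; exact: chain_W.
  have th := sys_dominated (fun x => Ep (- x)) Vb (sys_reflect (hyp kn'))
    (sys_reflect (hyp' kn')) Wr (IH kn').
  move=> e /th[X HX]; exists X => x /HX; rewrite !normrN; exact: next_scale.
move=> k kn; have Ep : forall x, 0 < Eseq V k.+1 x by apply: E0; lia.
have le0 := dominated_sys_prod_le0 (fun x => Ep (- x)) (sys_reflect (hyp kn))
  (sys_reflect (hyp' kn)) (key k kn).
split=> [x|e e0]; first by have := le0 (- x); rewrite opprK mulrN oppr_le0.
have [X HX] := sys_decay (fun x => Ep (- x)) Vb (sys_reflect (hyp kn)) le0 e0.
by exists X => x /HX; rewrite normrN.
Qed.

End Recessive.
End Chain.

(** If [V'] is nonnegative at one point, [V] is nondecreasing after it. Otherwise [V] is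
    nonincreasing, so the density is at least [expR (- V 0)] on the positive half-line and its
    primitive [N] would exceed [B]. *)
Lemma convex_bounded_below_right (R : realType) (V V1 V2 N : R -> R) (B : R) :
  (forall x, isd x V (V1 x)) -> (forall x, isd x V1 (V2 x)) -> (forall x, 0 <= V2 x) ->
  (forall x, isd x N (expR (- V x))) -> (forall x, N x <= B) -> bounded_below_right V.
Proof.
move=> dV dV1 V20 dN NB.
have [[X V1X]|neg] := pselect (exists X, 0 <= V1 X).
  exists X, (V X) => x Xx; apply: (isd_ge0_le dV Xx) => z /andP[Xz _].
  by apply: (le_trans V1X); apply: (isd_ge0_le dV1 (ltW Xz)).
have {}neg x : V1 x <= 0 by rewrite leNgt; apply/negP => V1x; apply: neg; exists x; exact: ltW.
pose c := expR (- V 0); have c0 : 0 < c by exact: expR_gt0.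
(* The linear lower bound [N 0 + c * x] equals [B + 1] here. *)
pose x := (B - N 0 + 1) / c.
have x0 : 0 <= x by rewrite divr_ge0 ?(ltW c0)// addr_ge0// subr_ge0.
have : N 0 - c * 0 <= N x - c * x.
  apply: (@isd_ge0_le _ (fun x => N x - c * x) (fun x => expR (- V x) - c)) => // z.
    by der (exact: dN); ring.
  move=> /andP[z0 _]; rewrite subr_ge0 ler_expR lerN2.
  by apply: (isd_le0_ge dV (ltW z0)).
have -> : c * x = B - N 0 + 1 by rewrite /x mulrC divfK// gt_eqF.
by have := NB x; lra.
Qed.

(** * Exchange of a pairing for a norm *)

Section Pairing.
Context {R : realType} (V E F y th : R -> R) (K : R).
Context (mu : probability (measurableTypeR R) R).
Hypothesis cV : continuous V.
Hypothesis kE : class_C 1 E.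
Hypothesis E0 : forall x, 0 < E x.
Hypothesis muE : forall A : set (measurableTypeR R), measurable A ->
  mu A = (\int[lebesgue_measure]_(x in A) (expR (- V x))%:E)%E.
Hypothesis kF : class_C 1 F.
Hypothesis FK : supported K F.

Lemma L2norm_sqrt : L2norm mu (fun x => (Num.sqrt (E x))^-1 * F x) ^+ 2 =
  \int[mu]_x ((E x)^-1 * F x ^+ 2).
Proof.
have s0 x : Num.sqrt (E x) != 0 by rewrite gt_eqF// sqrtr_gt0.
have c : continuous (fun x => (Num.sqrt (E x))^-1 * F x).
  exact: class_C_continuous (class_CM (class_CV s0 (class_C_sqrt E0 kE)) kF).
have Ls := @supported_L2 _ mu _ K c (supportedMr _ FK).
rewrite /L2norm (Lnorm2_fin Ls) /= sqr_sqrtr; last first.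
  exact: si_ge0 (L2_semi_inner mu) _ Ls.
apply: eq_Rintegral => x _; rewrite -[in RHS](sqr_sqrtr (ltW (E0 x))).
by field.
Qed.

(** The compactly supported function [E^-1 F th] has a derivative of zero Lebesgue integral;
    eliminating [th'] by the equation produces the three terms. *)
Lemma sys_pairing : sys V E F y th -> \int[mu]_x (y x * F x) =
  \int[mu]_x ((E x)^-1 * F x ^+ 2) -
  \int[mu]_x (expR (V x) * th x * D_Einv E F x).
Proof.
move=> h; have cy := isd_continuous h.1; have cth := isd_continuous h.2.
have En0 x : E x != 0 by rewrite gt_eqF.
have kEV : class_C 1 (fun x => (E x)^-1) := class_CV En0 kE.
have kW : class_C 1 (fun x => (E x)^-1 * F x) := class_CM kEV kF.
have dW x : isd x (fun x => (E x)^-1 * F x) (D_Einv E F x) := class_C_is_derive x kW.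
have kF0 := class_CW (leq0n 1) kF; have kE0 := class_CW (leq0n 1) kE.
have kEV0 := class_CW (leq0n 1) kEV; have kg0 := class_C_derive1 kW.
have ky : class_C 0 y by exact/class_C0.
have kth : class_C 0 th by exact/class_C0.
have kX : class_C 0 (fun x => expR (V x)) by apply/class_C_expR/class_C0.
have kXN : class_C 0 (fun x => expR (- V x)) by apply/class_C_expR/class_CN/class_C0.
have WK : supported K (fun x => (E x)^-1 * F x) by exact: supportedMr.
have gK : supported K (D_Einv E F) := supported_isd dW WK.
pose P x := (E x)^-1 * F x * th x.
pose p x := D_Einv E F x * th x + (E x)^-1 * F x * (expR (- V x) * (E x * y x - F x)).
have dP x : isd x P (p x) by apply: isdM; [exact: dW|exact: h.2].
have cp : continuous p.
  apply/class_C0/class_CD; first exact: class_CM.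
  apply: class_CM; first exact: class_CM.
  by apply: class_CM => //; apply: class_CB => //; exact: class_CM.
have PK : supported K P by exact: supportedMl.
have := mu_int_deriv0 cV muE dP cp PK.
have i1 : mu.-integrable setT (EFin \o (fun x => y x * F x)).
  by apply: (@supported_integrable _ _ _ K) => //; [exact/class_C0/class_CM|exact: supportedMr].
have i2 : mu.-integrable setT (EFin \o (fun x => (E x)^-1 * F x ^+ 2)).
  apply: (@supported_integrable _ _ _ K) => //.
    by apply/class_C0/class_CM => //; exact: class_CX.
  by move=> x Kx; rewrite FK// expr0n mulr0.
have i3 : mu.-integrable setT (EFin \o (fun x => expR (V x) * th x * D_Einv E F x)).
  apply: (@supported_integrable _ _ _ K) => //; last exact: supportedMr.
  by apply/class_C0; exact: class_CM (class_CM kX kth) kg0.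
have i13 : mu.-integrable setT
    (EFin \o (fun x => y x * F x + expR (V x) * th x * D_Einv E F x)).
  exact: (integrableD measurableT i1 i3).
rewrite (@eq_Rintegral _ _ _ mu _ (fun x => y x * F x + expR (V x) * th x * D_Einv E F x -
  (E x)^-1 * F x ^+ 2)); last first.
  by move=> x _; rewrite /p expRN; field; rewrite expR_eq0 En0.
by rewrite RintegralB// RintegralD//; lra.
Qed.

End Pairing.

Theorem theorem3 (R : realType) (n : nat) (V : R -> R)
    (mu : probability (measurableTypeR R) R)
    (hn : (1 <= n)%N)
    (Vconvex : convex_function [set: R^o] V)
    (Vreg : class_C (2 * n + 1) V)
    (muE : forall A : set (measurableTypeR R), measurable A ->
      mu A = (\int[lebesgue_measure]_(x in A) (expR (- V x))%:E)%E)
    (Epos : forall j, (1 <= j <= n)%N -> forall x, 0 < Eseq V j x)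
    (f : R -> R) (fsupp : compact_support f) (freg : class_C n.+1 f) :
  let E := Eseq V in
  let S := \sum_(1 <= j < n.+1) (-1) ^+ j.-1 *
             L2norm mu (fun x => (Num.sqrt (E j x))^-1 * fseq V f j x) ^+ 2 in
  let g := D_Einv (E n) (fseq V f n) in
  [/\ Var mu f =
        S + (-1) ^+ n * L2inner mu (inv_id_plus (DEinvDstar mu V (E n)) g) g,
      ~~ odd n -> S <= Var mu f &
      odd n -> Var mu f <= S].
Proof.
move=> E S g.
have kV2 : class_C 2 V by apply: class_CW Vreg; lia.
have cV := class_C_continuous kV2.
have kf1 : class_C 1 f by apply: class_CW freg; lia.
have cf := class_C_continuous kf1.
have [K K0 fK] := compact_supported fsupp.
have kE j : (1 <= j <= n)%N -> class_C 1 (E j).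
  by move=> jn; apply: class_CW (Eseq_class_C Vreg Epos jn); lia.
have kF j : (1 <= j <= n)%N -> class_C 1 (fseq V f j).
  by move=> jn; apply: class_CW (fseq_class_C Vreg freg Epos jn); lia.
have FK j : supported K (fseq V f j) by exact: fseq_supported.
have n1 : (1 <= 1 <= n)%N by lia.
have dV x : isd x V (derive1 V x) by exact: class_C_is_derive kV2.
have dV1 x : isd x (derive1 V) (E 1%N x) := class_C_is_derive x (class_C_derive1 kV2).
have df x : isd x f (derive1 f x) by exact: class_C_is_derive kf1.
pose N := cumul mu.
have dN x : isd x N (expR (- V x)) by exact: isd_cumul.
have N0 x : 0 <= N x by exact: cumul_ge0.
have N1 x : N x <= 1 by exact: cumul_le1.
pose m := \int[mu]_x f x.
pose w x := f x * expR (- V x).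
have cw : continuous w.
  by apply/class_C0/class_CM; [exact/class_C0|apply/class_C_expR/class_CN/class_C0].
have wK : supported K w by exact: supportedMl.
have [G dG G0] := supported_primitive cw wK.
have Gm x : K < x -> G x = m.
  move=> Kx; have xK : - (K + 1) < x by lra.
  have := mu_FTC cV muE xK dG cw.
  rewrite (G0 (- (K + 1))) ?subr0; last by lra.
  under eq_integral do rewrite /w -mulrA -expRD addNr expR0 mulr1.
  move=> H; rewrite /m (@Rintegral_supported _ mu f K (- (K + 1)) x)//; [|lra|exact: ltW].
  by rewrite /Rintegral H.
(* The integral of [m - f] over []-oo, x]] against [mu]: it is [m * N] to the left of the support
   and [- m * (1 - N)] to its right, the origin of [psiL] and [psiR]. *)
pose Phi x := m * N x - G x.
have dPhi x : isd x Phi (- (f x - m) * expR (- V x)).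
  by rewrite /Phi; der (first [exact: dN | exact: dG]); rewrite /w; ring.
have dfm x : isd x (fun x => f x - m) (derive1 f x).
  by der (exact: df); ring.
pose psi := chain V (fseq V f) (start V Phi (fun x => f x - m)).
have hpsi k : (k < n)%N -> sys V (E k.+1) (fseq V f k.+1) (psi k).1 (psi k).2.
  by apply: (chain_sys Vreg Epos kF) => //; exact: start_sys.
pose zero (j : nat) (x : R) : R := 0.
have Vr : bounded_below_right V.
  by apply: (convex_bounded_below_right dV dV1 _ dN N1) => x; rewrite ltW// Epos.
have Vl : bounded_below_right (fun x => V (- x)).
  apply: (@convex_bounded_below_right _ _ (fun x => - derive1 V (- x))
    (fun x => E 1%N (- x)) (fun x => - N (- x)) 0) => x.
  - exact: isd_opp.
  - by apply: isd_eq; [apply: isdN; apply: isd_opp; exact: dV1|rewrite opprK].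
  - by rewrite ltW// Epos.
  - by apply: isd_eq; [apply: isdN; apply: isd_opp; exact: dN|rewrite opprK].
  - by rewrite oppr_le0.
(* The first components are the dominating solution [expR (V x)] and the Mills ratios of the right
   and left tails; the last argument of [start] is each time [- expR (V x)] times the derivative of
   the preceding one. *)
pose pD := start V (fun=> 1) (fun=> 0).
pose pR := start V (fun x => 1 - N x) (fun=> 1).
pose pL := start V N (fun=> -1).
have hD : sys V (E 1%N) (fun=> 0) pD.1 pD.2.
  apply: start_sys => // x; last exact: isd_cst.
  by apply: isd_eq; [exact: isd_cst|ring].
have hR : sys V (E 1%N) (fun=> 0) pR.1 pR.2.
  apply: start_sys => // x; last exact: isd_cst.
  by der (exact: dN); ring.
have hL : sys V (E 1%N) (fun=> 0) pL.1 pL.2.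
  apply: start_sys => // x; last exact: isd_cst.
  by apply: isd_eq; [exact: dN|ring].
have WR x : pR.1 x * pD.2 x - pR.2 x * pD.1 x != 0.
  rewrite /= expRN (_ : _ - _ = 1) ?oner_neq0//.
  by field; rewrite expR_eq0.
have WL x : pL.1 x * pD.2 x - pL.2 x * pD.1 x != 0.
  rewrite /= expRN (_ : _ - _ = -1) ?oppr_eq0 ?oner_neq0//.
  by field; rewrite expR_eq0.
have DR : dominated pR.1 pD.1.
  move=> e /(cumul_cvgy mu)[X HX]; exists X => x /HX Nx.
  rewrite /= mulr1 normrM mulrC ltr_pM2r// normr_gt0 expR_eq0//.
have DL : dominated (fun x => pL.1 (- x)) (fun x => pD.1 (- x)).
  move=> e /(cumul_cvgNy mu)[X HX]; exists (- X) => x xX.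
  have /HX Nx : - x < X by rewrite ltrNl.
  rewrite /= mulr1 normrM mulrC ltr_pM2r// normr_gt0 expR_eq0//.
have rec_right := chain_recessive_right Vreg Epos hR hD WR Vr DR.
have rec_left := chain_recessive_left Vreg Epos hL hD WL Vl DL.
have psiR k x : K < x -> (psi k).1 x = - m * (chain V zero pR k).1 x /\
    (psi k).2 x = - m * (chain V zero pR k).2 x.
  move=> Kx; have Kx' : K < `|x| by rewrite gtr0_norm// (lt_trans K0).
  apply: chain_local => //; first by move=> j; exact: FK.
  - by rewrite /= /Phi Gm//; ring.
  - by rewrite /= /Phi Gm// fK//; ring.
have psiL k x : x < - K -> (psi k).1 x = m * (chain V zero pL k).1 x /\
    (psi k).2 x = m * (chain V zero pL k).2 x.
  move=> Kx; have Kx' : K < `|x| by rewrite ltr0_norm; lra.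
  apply: chain_local => //; first by move=> j; exact: FK.
  - by rewrite /= /Phi G0//; ring.
  - by rewrite /= /Phi G0// fK//; ring.
have pairing k : (k < n)%N -> \int[mu]_x ((psi k).1 x * fseq V f k.+1 x) =
    L2norm mu (fun x => (Num.sqrt (E k.+1 x))^-1 * fseq V f k.+1 x) ^+ 2 -
    \int[mu]_x (expR (V x) * (psi k).2 x * D_Einv (E k.+1) (fseq V f k.+1) x).
  move=> kn; have jn : (1 <= k.+1 <= n)%N by lia.
  rewrite (L2norm_sqrt mu (kE _ jn) (Epos _ jn) (kF _ jn) (FK _)).
  exact: (sys_pairing cV (kE _ jn) (Epos _ jn) muE (kF _ jn) (FK _) (hpsi k kn)).
have base : Var mu f = \int[mu]_x ((psi 0%N).1 x * fseq V f 1 x).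
  (* The derivative of the compactly supported [Phi * f]; times [expR (V x)] it is
     [(psi 0).1 * f' - f^2 + m f], and the last term integrates to [m ^+ 2]. *)
  pose p x := - (f x - m) * expR (- V x) * f x + Phi x * derive1 f x.
  have dP x : isd x (fun x => Phi x * f x) (p x) by exact: isdM.
  have kPhi : class_C 0 Phi by exact/class_C0/(isd_continuous dPhi).
  have kf0 : class_C 0 f by exact/class_C0.
  have kfm : class_C 0 (fun x => f x - m) := class_CB kf0 (class_C_cst 0 m).
  have kf'0 := class_C_derive1 kf1.
  have kX : class_C 0 (fun x => expR (V x)) by apply/class_C_expR/class_C0.
  have kXN : class_C 0 (fun x => expR (- V x)) by apply/class_C_expR/class_CN/class_C0.
  have cp : continuous p.
    apply/class_C0; apply: class_CD (class_CM kPhi kf'0).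
    exact: class_CM (class_CM (class_CN kfm) kXN) kf0.
  have := mu_int_deriv0 cV muE dP cp (supportedMr _ fK).
  have i1 : mu.-integrable setT (EFin \o (fun x => (psi 0%N).1 x * fseq V f 1 x)).
    apply: (@supported_integrable _ _ _ K) => //.
      by apply/class_C0; exact: class_CM (class_CM kX kPhi) kf'0.
    by apply: supportedMr; exact: FK.
  have i2 : mu.-integrable setT (EFin \o (fun x => f x ^+ 2)).
    apply: (@supported_integrable _ _ _ K) => //; first exact/class_C0/class_CX.
    by move=> x /fK ->; rewrite expr0n.
  have i3 : mu.-integrable setT (EFin \o f) by exact: supported_integrable fK.
  have i4 : mu.-integrable setT (EFin \o (fun x => m * f x)).
    exact: (integrableZl measurableT m i3).
  have i12 : mu.-integrable setT
      (EFin \o (fun x => (psi 0%N).1 x * fseq V f 1 x - f x ^+ 2)).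
    exact: (integrableB measurableT i1 i2).
  rewrite (@eq_Rintegral _ _ _ mu _ (fun x => ((psi 0%N).1 x * fseq V f 1 x - f x ^+ 2) +
    m * f x)); last first.
    by move=> x _; rewrite /p /psi /= expRN; field; rewrite expR_eq0.
  rewrite RintegralD// RintegralB// RintegralZl// -/m /Var -/m => H.
  by rewrite expr2; lra.
have var k : (k < n)%N -> Var mu f = \sum_(1 <= j < k.+1) (-1) ^+ j.-1 *
      L2norm mu (fun x => (Num.sqrt (E j x))^-1 * fseq V f j x) ^+ 2 +
    (-1) ^+ k * \int[mu]_x ((psi k).1 x * fseq V f k.+1 x).
  elim: k => [_|k IH kn]; first by rewrite big_geq// base add0r expr0 mul1r.
  have kn' : (k < n)%N by lia.
  rewrite (IH kn') pairing// [in RHS]big_nat_recr//= -addrA; congr (_ + _).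
  rewrite mulrBr; congr (_ + _); rewrite exprS mulN1r mulNr; congr (- (_ * _)).
  have Ep := Epos k.+1 ltac:(lia).
  (* The factors [E^(-1/2)] of the next solution and [E^(1/2)] of the next [fseq] cancel. *)
  apply: eq_Rintegral => x _; rewrite /psi /= /E.
  have t0 : Num.sqrt (Eseq V k.+1 x) != 0 by rewrite gt_eqF// sqrtr_gt0.
  by move: (D_Einv _ _ x) => b; field.
have kn : (n.-1 < n)%N by rewrite prednK.
have nE : n.-1.+1 = n by rewrite prednK.
have nn : (1 <= n <= n)%N by rewrite hn leqnn.
(* [psi] is indexed from 0, so the solution of rank [n] is [psi n.-1], and [u] is its derivative. *)
pose u x := expR (V x) * (psi n.-1).2 x.
have hn' : sys V (E n) (fseq V f n) (psi n.-1).1 (psi n.-1).2.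
  by have := hpsi _ kn; rewrite nE.
have [rr1 rr2] := rec_right _ kn; have [rl1 rl2] := rec_left _ kn.
have [Lg ug] : g \in Lfun mu 2%:E /\ DEinvDstar mu V (E n) u (g \- u).
  apply: (sys_form_op kV2 (kE _ nn) (Epos _ nn) muE (kF _ nn) (FK n) K0 hn').
  - move=> x Kx; have [-> ->] := psiR n.-1 x Kx.
    by rewrite mulrACA -expr2; apply: mulr_ge0_le0; [exact: sqr_ge0|exact: rr1].
  - move=> x Kx; have [-> ->] := psiL n.-1 x Kx.
    by rewrite mulrACA -expr2; apply: mulr_ge0; [exact: sqr_ge0|exact: rl1].
  (* Far out, [(psi n.-1).2] is [m] or [- m] times a decaying function; the divisor is [|m| + 1]
     because [m] may be 0. *)
  - move=> e e0; have m1 : 0 < `|m| + 1 by rewrite ltr_wpDl.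
    have em : 0 < e / (`|m| + 1) by rewrite divr_gt0.
    have [X HX] := rr2 _ em; have [Y HY] := rl2 _ em.
    have small a : `|a| < e / (`|m| + 1) -> `|m| * `|a| < e.
      rewrite ltr_pdivlMr// mulrDr mulr1 [`|m| * _]mulrC; have := normr_ge0 a; lra.
    exists (Num.max K (Num.max X Y)) => x; rewrite !gt_max => /and3P[Kx Xx Yx].
    have [x0|x0] := leP 0 x.
      rewrite ger0_norm// in Kx Xx; have [_ ->] := psiR n.-1 x Kx.
      by rewrite normrM normrN; apply: small; exact: HX.
    rewrite ltr0_norm// in Kx Yx; have [|_ ->] := psiL n.-1 x; first by rewrite ltrNr.
    by rewrite normrM; apply: small; have := HY _ Yx; rewrite opprK.
have Epn := Epos _ nn.
have [-> pos] := inv_id_plus_inner (bform_semi_inner mu kV2 (kE _ nn) Epn)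
  (fun u => @bform_diag _ V (E n) mu u) (@test_L2 _ mu) (bform_reprC kV2 (kE _ nn) Epn muE) Lg ug.
have sgn : (-1) ^+ n = - (-1) ^+ n.-1 :> R by rewrite -{1}nE exprS mulN1r.
have SE : S = \sum_(1 <= j < n) (-1) ^+ j.-1 *
      L2norm mu (fun x => (Num.sqrt (E j x))^-1 * fseq V f j x) ^+ 2 +
    (-1) ^+ n.-1 * L2norm mu (fun x => (Num.sqrt (E n x))^-1 * fseq V f n x) ^+ 2.
  by rewrite /S -{1}nE big_nat_recr ?nE.
have main : Var mu f = S + (-1) ^+ n * L2inner mu u g.
  have := var _ kn; rewrite pairing// nE => ->.
  rewrite SE -addrA; congr (_ + _).
  by rewrite mulrBr sgn mulNr.
split=> // [en|on]; rewrite main.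
  by rewrite -signr_odd (negbTE en) expr0 mul1r lerDl.
by rewrite -signr_odd on expr1 mulN1r gerBl.
Qed.
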